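(* Let $\phi_0$ and $\phi_1$ be two $c$-convex functions on $S^n$. Let $x\in S^n$ be a point such that, for each $i=0,1$, $|\nabla\phi_i(x)|<\pi$ and $\phi_i$ has its Hessian defined at $x$. For $t\in[0,1]$ put $\phi_t=(1-t)\phi_0+t\phi_1$, $F_t=G_{\phi_t}$ and $J_t(x)=\mathrm{Jac}(F_t(x))$. Then $J_t(x)$ is log-concave with respect to $t\in[0,1]$; equivalently, $$\log J_t(x)\ \geq\ (1-t)\log J_0(x)+t\log J_1(x),\qquad t\in[0,1].$$
   Context: $S^n\subset\mathbb{R}^{n+1}$ is the $n$-dimensional unit sphere with its standard Riemannian metric, $d(x,y)=\cos^{-1}(x^{\top}y)\in[0,\pi]$ is the geodesic distance, and the cost function is $c(x,y)=\frac12 d(x,y)^2$. The $c$-transform of $\phi:S^n\to\mathbb{R}$ is $\phi^c(y)=\sup_{x\in S^n}\{-c(x,y)-\phi(x)\}$, and $\phi$ is $c$-convex if $(\phi^c)^c=\phi$. The exponential map is $\exp_x(v)=(\cos|v|)x+(\sin|v|)v/|v|$ for $v\in T_xS^n$ (with $\exp_x(0)=x$). If $\phi$ is differentiable at $x$, the gradient map associated with $\phi$ is $G_\phi(x)=\exp_x(\nabla\phi(x))$, with $\nabla$ the Riemannian gradient. ''$\phi$ has its Hessian defined at $x$'' means that $\phi$ is twice differentiable at $x$ (differentiable near $x$, with gradient differentiable at $x$), so that $G_\phi$ is differentiable at $x$ when $|\nabla\phi(x)|<\pi$. $\mathrm{Jac}(F_t(x))=\det(dF_t/dx)$ is the determinant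 of the differential $T_xS^n\to T_{F_t(x)}S^n$ computed in orthonormal bases that are positively oriented with respect to a fixed orientation of $S^n$. Under the hypotheses, $|\nabla\phi_t(x)|<\pi$ and $\phi_t$ has its Hessian at $x$ for all $t\in[0,1]$, so $J_t(x)$ is defined; the convention is $\log 0=-\infty$ (in the inequality, $0\cdot(-\infty)=0$). *)

(* Defs.v *)
From HB Require Import structures.
From mathcomp Require Import all_boot all_order all_algebra.
From mathcomp Require Import all_classical all_reals all_analysis.

Set Implicit Arguments.
Unset Strict Implicit.
Unset Printing Implicit Defensive.

Import Order.TTheory GRing.Theory Num.Theory.
Import numFieldNormedType.Exports.

Local Open Scope classical_set_scope.
Local Open Scope ring_scope.

(* R^{n+1} is 'rV[R]_n.+1.  The canonical norm `|v| of a matrix is the sup norm;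
   it induces the usual topology and the usual notion of differentiability, but
   lengths of vectors must be measured with [enorm].
   A function on S^n is represented by a total function on R^{n+1}; none of the
   definitions below looks at its values outside the sphere. *)

Definition dotv (R : realType) (m : nat) (u v : 'rV[R]_m) : R :=
  (u *m v^T) 0 0.

Definition enorm (R : realType) (m : nat) (u : 'rV[R]_m) : R :=
  Num.sqrt (dotv u u).

Definition sphere (R : realType) (n : nat) : set 'rV[R]_n.+1 :=
  [set x | enorm x = 1].
Arguments sphere {R n}.

Definition tangent (R : realType) (n : nat) (x : 'rV[R]_n.+1) :
    set 'rV[R]_n.+1 :=
  [set v | dotv x v = 0].

Definition geodist (R : realType) (n : nat) (x y : 'rV[R]_n.+1) : R :=
  acos (dotv x y).

Definition cost (R : realType) (n : nat) (x y : 'rV[R]_n.+1) : R :=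
  2^-1 * geodist x y ^+ 2.

(* Extended-real valued, since the supremum is +oo when psi is not bounded
   below; hence the double transform below involves no convention on the
   supremum of unbounded sets. *)
Definition ctransform (R : realType) (n : nat) (psi : 'rV[R]_n.+1 -> \bar R)
    (y : 'rV[R]_n.+1) : \bar R :=
  ereal_sup [set ((- cost x y)%:E - psi x)%E | x in sphere].

Definition c_convex (R : realType) (n : nat) (phi : 'rV[R]_n.+1 -> R) : Prop :=
  forall x, sphere x ->
    ctransform (ctransform (fun z => (phi z)%:E)) x = (phi x)%:E.

(* At v = 0 the second term vanishes, so that [sexp x 0 = x]. *)
Definition sexp (R : realType) (n : nat) (x v : 'rV[R]_n.+1) : 'rV[R]_n.+1 :=
  cos (enorm v) *: x + (sin (enorm v) / enorm v) *: v.

(* Differential calculus on the submanifold S^n of R^{n+1}: f is extended to a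
   neighbourhood of the sphere by precomposition with the smooth retraction
   z |-> z / |z|.  The map f is differentiable at x in S^n iff its extension
   is, and df_x is the restriction to the tangent space of the differential of
   the extension. *)
Definition radial (R : realType) (n : nat) (V : Type) (f : 'rV[R]_n.+1 -> V) :
    'rV[R]_n.+1 -> V :=
  fun z => f ((enorm z)^-1 *: z).

Definition sdifferentiable (R : realType) (n : nat) (V : normedModType R)
    (f : 'rV[R]_n.+1 -> V) (x : 'rV[R]_n.+1) : Prop :=
  differentiable (radial f) x.

Definition sdiff (R : realType) (n : nat) (V : normedModType R)
    (f : 'rV[R]_n.+1 -> V) (x v : 'rV[R]_n.+1) : V :=
  'd (radial f) x v.

(* The unique tangent vector representing df_x (meaningful when f is
   differentiable at x in S^n). *)
Definition sgrad (R : realType) (n : nat) (phi : 'rV[R]_n.+1 -> R)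
    (x : 'rV[R]_n.+1) : 'rV[R]_n.+1 :=
  xget 0 [set g | tangent x g /\
                  forall v, tangent x v -> sdiff phi x v = dotv g v].

(* The gradient field is differentiated as a map from S^n to R^{n+1}. *)
Definition has_hessian (R : realType) (n : nat) (phi : 'rV[R]_n.+1 -> R)
    (x : 'rV[R]_n.+1) : Prop :=
  (\forall y \near x, sphere y -> sdifferentiable phi y) /\
  sdifferentiable (sgrad phi) x.

Definition gradmap (R : realType) (n : nat) (phi : 'rV[R]_n.+1 -> R)
    (x : 'rV[R]_n.+1) : 'rV[R]_n.+1 :=
  sexp x (sgrad phi x).

(* The rows of B form an orthonormal basis of the tangent space at x, positive
   for the orientation of S^n given by the outward normal. *)
Definition oriented_frame (R : realType) (n : nat) (x : 'rV[R]_n.+1)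
    (B : 'M[R]_(n, n.+1)) : Prop :=
  [/\ B *m B^T = 1%:M,
      forall i, tangent x (row i B)
    & 0 < \det (col_mx x B : 'M[R]_n.+1)].

Definition oframe (R : realType) (n : nat) (x : 'rV[R]_n.+1) :
    'M[R]_(n, n.+1) :=
  xget 0 [set B | oriented_frame x B].

(* Determinant of dF_x : T_x S^n -> T_{F x} S^n in positive orthonormal bases;
   it depends neither on the choice of these bases nor on the orientation. *)
Definition sjac (R : realType) (n : nat)
    (F : 'rV[R]_n.+1 -> 'rV[R]_n.+1) (x : 'rV[R]_n.+1) : R :=
  \det (\matrix_(i < n, j < n)
    dotv (row i (oframe (F x))) (sdiff F x (row j (oframe x)))).

Definition phi_interp (R : realType) (n : nat) (phi0 phi1 : 'rV[R]_n.+1 -> R)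
    (t : R) : 'rV[R]_n.+1 -> R :=
  fun z => (1 - t) * phi0 z + t * phi1 z.

Definition J_interp (R : realType) (n : nat) (phi0 phi1 : 'rV[R]_n.+1 -> R)
    (x : 'rV[R]_n.+1) (t : R) : R :=
  sjac (gradmap (phi_interp phi0 phi1 t)) x.

(* [lne 0 = -oo] and 0 * -oo = 0.  As [lne] is also -oo on negative numbers,
   nonnegativity of f has to be required explicitly. *)
Definition log_concave_on (R : realType) (D : set R) (f : R -> R) : Prop :=
  (forall t, D t -> 0 <= f t) /\
  forall s t l : R, D s -> D t -> 0 <= l <= 1 ->
    ((1 - l)%:E * lne (f s)%:E + l%:E * lne (f t)%:E
       <= lne (f ((1 - l) * s + l * t))%:E)%E.

(* Main.v *)
Require Import Defs.
From HB Require Import structures.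
From mathcomp Require Import all_boot all_order all_algebra.
From mathcomp Require Import all_classical all_reals all_analysis.
From mathcomp Require Import ring lra.

Set Implicit Arguments.
Unset Strict Implicit.
Unset Printing Implicit Defensive.

Import Order.TTheory GRing.Theory Num.Theory.
Import numFieldNormedType.Exports.

Local Open Scope classical_set_scope.
Local Open Scope ring_scope.

(** Write v = grad phi (x), r = |v| and y = exp_x v. Three facts give the
    result.

    First, the differential of the gradient map factors through exp_x: it is
    the differential of exp_x at v composed with the symmetric form
    Hess phi + Hess c(., y) on the tangent space at x. On the unit sphere the
    determinant of the first factor is (sin r / r)^(m-1), with m the dimension
    of the sphere, and the Hessian of the cost at x is
      w |-> r cot r |w|^2 + (1 - r cot r) <v, w>^2 / r^2.
    This is [sjac_gradmap]. Everything is written with square matrices of size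
    m+1 acting on the ambient space, the form being completed by the identity
    in the direction of x ([jac_form]), so that no basis of the tangent space
    appears except in the definition of the Jacobian.

    Second, if phi is c-convex then y is a c-subgradient of phi at x, that is,
    phi + c(., y) has a minimum at x; hence Hess phi + Hess c(., y) is
    nonnegative at x ([c_convex_support], [second_order]). It is symmetric
    because the second derivative of a function that is differentiable near x
    with gradient differentiable at x is symmetric ([schwarz]).

    Third, for fixed w the Hessian of the cost is concave in v on the ball of
    radius pi ([hess_cost_concave]). This is where the geometry of the sphere
    enters: it says that the sphere has nonnegative cross-curvature. Its proof
    rests on the half-angle formula
      1 - r cot r = (1 - r/2 cot (r/2)) + r/2 tan (r/2),
    which splits the form into the form at v/2 and a term of the shape
    (quadratic form in v) / (r/2 cot (r/2)), convex in v because r cot r is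
    concave and nonincreasing; after k halvings what remains is O(4^-k).

    Along the segment v_t = (1 - t) v_0 + t v_1 the forms
    Hess phi_t + Hess c(., exp_x v_t) are therefore bounded below by the linear
    interpolation of the forms at any two parameters, and all of them are
    positive semidefinite since those at 0 and 1 are. The determinant is
    monotone and log-concave on positive semidefinite matrices
    ([det_log_concave]), and sin r / r is log-concave and nonincreasing in r
    ([ln_sinc_concave]), so that the Jacobian, a product of a power of the
    latter with a determinant, is log-concave in t. *)

(** * The Euclidean inner product *)

Section Dot.
Variables (R : realType) (m : nat).
Implicit Types u v w : 'rV[R]_m.

Lemma dotvE u v : dotv u v = \sum_i u 0 i * v 0 i.
Proof. by rewrite /dotv mxE; apply: eq_bigr => i _; rewrite mxE. Qed.

Lemma dotvC u v : dotv u v = dotv v u.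
Proof. by rewrite !dotvE; apply: eq_bigr => i _; rewrite mulrC. Qed.

Lemma dotvDl u v w : dotv (u + v) w = dotv u w + dotv v w.
Proof. by rewrite /dotv mulmxDl mxE. Qed.

Lemma dotvDr u v w : dotv w (u + v) = dotv w u + dotv w v.
Proof. by rewrite !(dotvC w) dotvDl. Qed.

Lemma dotvZl a u v : dotv (a *: u) v = a * dotv u v.
Proof. by rewrite /dotv -scalemxAl mxE. Qed.

Lemma dotvZr a u v : dotv u (a *: v) = a * dotv u v.
Proof. by rewrite !(dotvC u) dotvZl. Qed.

Lemma dotvNl u v : dotv (- u) v = - dotv u v.
Proof. by rewrite -scaleN1r dotvZl mulN1r. Qed.

Lemma dotvNr u v : dotv u (- v) = - dotv u v.
Proof. by rewrite !(dotvC u) dotvNl. Qed.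

Lemma dotvBl u v w : dotv (u - v) w = dotv u w - dotv v w.
Proof. by rewrite dotvDl dotvNl. Qed.

Lemma dotvBr u v w : dotv w (u - v) = dotv w u - dotv w v.
Proof. by rewrite dotvDr dotvNr. Qed.

Lemma dot0v u : dotv 0 u = 0.
Proof. by rewrite /dotv mul0mx mxE. Qed.

Lemma dotv0 u : dotv u 0 = 0.
Proof. by rewrite dotvC dot0v. Qed.

Lemma dotv_ge0 u : 0 <= dotv u u.
Proof. by rewrite dotvE sumr_ge0 // => i _; rewrite -expr2 sqr_ge0. Qed.

Lemma dotv_eq0 u : (dotv u u == 0) = (u == 0).
Proof.
apply/eqP/eqP => [|->]; last by rewrite dot0v.
rewrite dotvE => /eqP; rewrite psumr_eq0; last by move=> i _; rewrite -expr2 sqr_ge0.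
move=> /allP h; apply/rowP => i; rewrite mxE.
by have := h i (mem_index_enum _); rewrite /= -expr2 sqrf_eq0 => /eqP.
Qed.

Lemma dotv_delta u i : dotv u (delta_mx 0 i) = u 0 i.
Proof. by rewrite /dotv trmx_delta -colE mxE. Qed.

Lemma enorm_ge0 u : 0 <= enorm u.
Proof. exact: sqrtr_ge0. Qed.

Lemma enorm_sq u : enorm u ^+ 2 = dotv u u.
Proof. by rewrite sqr_sqrtr ?dotv_ge0. Qed.

Lemma enorm_eq0 u : (enorm u == 0) = (u == 0).
Proof. by rewrite -sqrf_eq0 enorm_sq dotv_eq0. Qed.

Lemma enorm0 : enorm (0 : 'rV[R]_m) = 0.
Proof. by apply/eqP; rewrite enorm_eq0. Qed.

Lemma enormZ a u : enorm (a *: u) = `|a| * enorm u.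
Proof.
by rewrite /enorm dotvZl dotvZr mulrA -expr2 sqrtrM ?sqr_ge0// sqrtr_sqr.
Qed.

(** Cauchy-Schwarz, from the squared length of a vector orthogonal to v. *)
Lemma dotv_cauchy u v : dotv u v ^+ 2 <= dotv u u * dotv v v.
Proof.
have [->|v0] := eqVneq v 0; first by rewrite !dotv0 mulr0 expr0n.
have vv : 0 < dotv v v by rewrite lt_neqAle dotv_ge0 andbT eq_sym dotv_eq0.
have := dotv_ge0 (dotv v v *: u - dotv u v *: v).
rewrite dotvBl !dotvBr !dotvZl !dotvZr (dotvC v u) => h.
suff : 0 <= dotv v v * (dotv u u * dotv v v - dotv u v ^+ 2).
  by rewrite pmulr_rge0 // subr_ge0.
by move: h; congr (_ <= _); ring.
Qed.

Lemma dotv_le_enorm u v : dotv u v <= enorm u * enorm v.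
Proof.
rewrite (le_trans (ler_norm _))//.
rewrite -(ler_pXn2r (n := 2))// ?nnegrE ?mulr_ge0 ?enorm_ge0//.
by rewrite real_normK ?num_real// exprMn !enorm_sq dotv_cauchy.
Qed.

Lemma enormD u v : enorm (u + v) <= enorm u + enorm v.
Proof.
rewrite -(ler_pXn2r (n := 2))// ?nnegrE ?addr_ge0 ?enorm_ge0//.
rewrite sqrrD !enorm_sq dotvDl !dotvDr (dotvC v u).
have := dotv_le_enorm u v; lra.
Qed.

Lemma dotv_mulmx (A : 'M[R]_m) u v : dotv (u *m A) v = dotv u (v *m A^T).
Proof. by rewrite /dotv trmx_mul trmxK mulmxA. Qed.

End Dot.

Lemma dotv_row_mx (R : realType) m p (a c : 'rV[R]_m) (b d : 'rV[R]_p) :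
  dotv (row_mx a b) (row_mx c d) = dotv a c + dotv b d.
Proof. by rewrite /dotv tr_row_mx mul_row_col mxE. Qed.

(** * Determinants of positive semidefinite matrices *)

Definition qform (R : realType) m (A : 'M[R]_m) (u : 'rV[R]_m) : R :=
  dotv (u *m A) u.

Definition psd (R : realType) m (A : 'M[R]_m) : Prop :=
  A^T = A /\ forall u, 0 <= qform A u.

Definition schur (R : realType) m (A : 'M[R]_(1 + m)) : 'M[R]_m :=
  drsubmx A - (A 0 0)^-1 *: (dlsubmx A *m ursubmx A).

Section Schur.
Variables (R : realType) (m : nat).
Implicit Types A : 'M[R]_(1 + m).

Lemma ulsubmx00 A : ulsubmx A = (A 0 0)%:M.
Proof. by rewrite [LHS]mx11_scalar !mxE; congr (A _ _)%:M; apply/val_inj. Qed.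

Lemma dlsubmx_sym A : A^T = A -> dlsubmx A = (ursubmx A)^T.
Proof. by move=> sA; rewrite -{1}sA; apply/matrixP => i j; rewrite !mxE. Qed.

Lemma det_schur A : A 0 0 != 0 -> \det A = A 0 0 * \det (schur A).
Proof.
move=> a0.
have E : A = block_mx 1%:M 0 ((A 0 0)^-1 *: dlsubmx A) 1%:M *m
            block_mx (A 0 0)%:M (ursubmx A) 0 (schur A) :> 'M[R]_(1 + m).
  rewrite mulmx_block !mul1mx !mul0mx ?mulmx0 !addr0 mul_mx_scalar scalerA mulfV//.
  by rewrite scale1r /schur -scalemxAl addrC subrK -[A in LHS]submxK ulsubmx00.
by rewrite [in LHS]E det_mulmx det_lblock det_ublock !det1 det_scalar1 !mul1r.
Qed.

Lemma schur_sym A : A^T = A -> (schur A)^T = schur A.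
Proof.
move=> sA; rewrite /schur (dlsubmx_sym sA) !linearD/= linearN/= linearZ/=.
rewrite trmx_mul trmxK; congr (_ - _).
by rewrite -{2}sA; apply/matrixP => i j; rewrite !mxE.
Qed.

(** Completion of the square in the first coordinate. It shows that the form
    of the Schur complement is the minimum of the form of A over the first
    coordinate; a minimum of affine functions of A is concave in A, which is
    what makes the induction of [det_log_concave] work. *)
Lemma qform_schur A (e : R) (u : 'rV[R]_m) : A^T = A -> A 0 0 != 0 ->
  qform A (row_mx e%:M u) =
  A 0 0 * (e + (A 0 0)^-1 * dotv (ursubmx A) u) ^+ 2 + qform (schur A) u.
Proof.
move=> sA a0; rewrite /qform -[A in LHS]submxK mul_row_block dotv_row_mx ulsubmx00.
rewrite (dlsubmx_sym sA) /schur mulmxBr dotvBl (dlsubmx_sym sA) !dotvDl.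
rewrite -scalemxAr dotvZl mulmxA !mul_scalar_mx !dotvZl.
have E (c f : R) : dotv (c%:M : 'rV[R]_1) f%:M = c * f.
  by rewrite dotvE big_ord1 !mxE eqxx !mulr1n.
have -> : u *m (ursubmx A)^T = (dotv (ursubmx A) u)%:M.
  by rewrite [LHS]mx11_scalar dotvC.
rewrite mul_scalar_mx dotvZl !E.
by field.
Qed.

Lemma qform_schur_min A (u : 'rV[R]_m) : A^T = A -> A 0 0 != 0 ->
  qform (schur A) u =
  qform A (row_mx (- ((A 0 0)^-1 * dotv (ursubmx A) u))%:M u).
Proof. by move=> sA a0; rewrite qform_schur// addNr expr0n mulr0 add0r. Qed.

Lemma qform_schur_le A e (u : 'rV[R]_m) : A^T = A -> 0 < A 0 0 ->
  qform (schur A) u <= qform A (row_mx e%:M u).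
Proof.
by move=> sA a0; rewrite qform_schur ?gt_eqF// lerDr mulr_ge0 ?sqr_ge0// ltW.
Qed.

Lemma psd_schur A : psd A -> A 0 0 != 0 -> psd (schur A).
Proof.
move=> [sA pA] a0; split; first exact: schur_sym.
by move=> u; rewrite qform_schur_min.
Qed.

(** If the corner entry vanishes, the form restricted to the first coordinate
    and to a multiple of the first row is affine in the former; being
    nonnegative it has slope zero, so the first row is zero. *)
Lemma psd_diag0 A : psd A -> A 0 0 = 0 -> \det A = 0.
Proof.
move=> [sA pA] a0.
have ur0 : ursubmx A = 0.
  set b := ursubmx A; apply/eqP; rewrite -dotv_eq0 eq_le dotv_ge0 andbT leNgt.
  apply/negP => b0; set d := qform (drsubmx A) b.
  have E (e : R) : qform A (row_mx e%:M b) = 2 * e * dotv b b + d.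
    rewrite /qform -[A]submxK mul_row_block dotv_row_mx ulsubmx00 a0.
    rewrite (dlsubmx_sym sA) -/b raddf0 mulmx0 add0r !dotvDl.
    have -> : b *m b^T = (dotv b b)%:M by rewrite [LHS]mx11_scalar.
    rewrite mul_scalar_mx dotvZl dotvE big_ord1 !mxE eqxx !mulr1n -/(qform _ _) -/d.
    by ring.
  (* the first coordinate at which the form takes the value -1 *)
  have := pA (row_mx (- ((d + 1) / (2 * dotv b b)))%:M b).
  rewrite E (_ : 2 * _ * _ = - (d + 1)); last by field; rewrite gt_eqF.
  by lra.
by rewrite -[A]submxK ulsubmx00 a0 ur0 det_lblock det_scalar1 mul0r.
Qed.

Lemma psd_diag_ge0 A : psd A -> 0 <= A 0 0.
Proof.
move=> [_ pA]; have := pA (delta_mx 0 0).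
by rewrite /qform -rowE dotv_delta mxE.
Qed.

End Schur.

Lemma psd_det_ge0 (R : realType) m (A : 'M[R]_m) : psd A -> 0 <= \det A.
Proof.
elim: m A => [|m IH] A pA; first by rewrite det_mx00.
have [a0|a0] := eqVneq ((A : 'M[R]_(1 + m)) 0 0) 0.
  by rewrite (psd_diag0 (m := m)).
by rewrite (det_schur (m := m)) // mulr_ge0 ?(psd_diag_ge0 (m := m))// IH//; exact: psd_schur.
Qed.

(** The case of size one, from the tangent line of ln at (1 - t) x + t y. *)
Lemma ln_concave2 (R : realType) (x y z t : R) : 0 <= t <= 1 -> 0 < x -> 0 < y ->
  (1 - t) * x + t * y <= z -> 0 < z /\ (1 - t) * ln x + t * ln y <= ln z.
Proof.
move=> /andP[t0 t1] x0 y0 h.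
have p0 : 0 < (1 - t) * x + t * y.
  have [->|tn] := eqVneq t 0; first by rewrite subr0 mul1r mul0r addr0.
  by rewrite ltr_wpDl ?mulr_ge0 ?subr_ge0 ?(ltW x0)// mulr_gt0// lt_neqAle eq_sym tn.
have z0 := lt_le_trans p0 h.
split=> //; set s := (1 - t) * x + t * y in p0 h *.
have L (a : R) : 0 < a -> ln a <= ln s + (a / s - 1).
  move=> a0; rewrite -lerBlDl -ln_div ?posrE//.
  have /le_ln1Dx : -1 < a / s - 1 by have := divr_gt0 a0 p0; lra.
  by rewrite addrC subrK.
have Lx := L x x0; have Ly := L y y0.
have Lz : ln s <= ln z by rewrite ler_ln ?posrE.
have E : (1 - t) * (x / s - 1) + t * (y / s - 1) = 0.
  transitivity (((1 - t) * x + t * y) / s - 1); first by ring.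
  by rewrite -/s divff ?gt_eqF// subrr.
have := ler_wpM2l t0 Ly; have : 0 <= 1 - t by rewrite subr_ge0.
move=> /ler_wpM2l/(_ _ _ Lx); lra.
Qed.

(** Monotonicity (X = Y) and log-concavity (Z = (1 - t) X + t Y) of the
    determinant are proved together: in the induction, the Schur complement of
    a convex combination only dominates the convex combination of the Schur
    complements. This avoids any diagonalization. *)
Lemma det_log_concave (R : realType) m (X Y Z : 'M[R]_m) (t : R) :
  0 <= t <= 1 -> psd X -> psd Y -> psd Z ->
  (forall u, (1 - t) * qform X u + t * qform Y u <= qform Z u) ->
  0 < \det X -> 0 < \det Y ->
  0 < \det Z /\ (1 - t) * ln (\det X) + t * ln (\det Y) <= ln (\det Z).
Proof.
move=> t01; elim: m X Y Z => [|m IH] X Y Z pX pY pZ h.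
  by rewrite !det_mx00 ln1 !mulr0 addr0 ltr01.
change 'M[R]_(1 + m) in X, Y, Z => dX dY.
have pos (A : 'M[R]_(1 + m)) : psd A -> 0 < \det A -> 0 < A 0 0.
  move=> pA dA; rewrite lt_neqAle psd_diag_ge0// andbT eq_sym.
  by apply/eqP => /(psd_diag0 pA) A0; rewrite A0 ltxx in dA.
have X0 := pos _ pX dX; have Y0 := pos _ pY dY.
have e00 (A : 'M[R]_(1 + m)) : qform A (delta_mx 0 0) = A 0 0.
  by rewrite /qform -rowE dotv_delta mxE.
have h00 := h (delta_mx 0 0); rewrite !e00 in h00.
have [Z0 lZ] := ln_concave2 t01 X0 Y0 h00.
have pos' (A : 'M[R]_(1 + m)) : 0 < A 0 0 -> 0 < \det A -> 0 < \det (schur A).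
  by move=> A0; rewrite det_schur ?gt_eqF// pmulr_rgt0.
have sX := pos' _ X0 dX; have sY := pos' _ Y0 dY.
have [||||||sZ lS] := IH (schur X) (schur Y) (schur Z).
- by apply: psd_schur; rewrite ?gt_eqF.
- by apply: psd_schur; rewrite ?gt_eqF.
- by apply: psd_schur; rewrite ?gt_eqF.
- move=> u; rewrite (qform_schur_min _ pZ.1) ?gt_eqF//; apply: le_trans (h _).
  case/andP: t01 => t0 t1.
  by apply: lerD; apply: ler_wpM2l; rewrite ?subr_ge0//; apply: qform_schur_le => //;
    [exact: pX.1|exact: pY.1].
- by [].
- by [].
rewrite !det_schur ?gt_eqF// !lnM ?posrE//; split; first exact: mulr_gt0.
lra.
Qed.

(** * Concavity of r cot r and of the logarithm of sin r / r *)

Section OneVar.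
Variable R : realType.
Implicit Types (a b r s t u v : R).

Lemma concave_tangent_le (f df : R -> R) b :
  (forall u, 0 < u < b -> is_derive u 1 f (df u)) ->
  (forall u v, 0 < u -> u <= v -> v < b -> df v <= df u) ->
  forall a r, 0 < a < b -> 0 < r < b -> f r <= f a + df a * (r - a).
Proof.
move=> fd dec.
have cont u v : 0 < u -> v < b -> {within `[u, v], continuous f}.
  move=> u0 vb; apply: derivable_within_continuous => z; rewrite in_itv/= => /andP[uz zv].
  by apply: ex_derive; apply: fd; rewrite (lt_le_trans u0 uz) (le_lt_trans zv vb).
move=> a r /andP[a0 ab] /andP[r0 rb].
have [ra|ar|->] := ltgtP r a; last by rewrite subrr mulr0 addr0.
- have [z|z|c] := @MVT R f df r a ra; [|exact: cont|].
    by rewrite in_itv/= => /andP[? ?]; apply: fd; rewrite (lt_trans r0)//= (lt_trans _ ab).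
  rewrite in_itv/= => /andP[rc ca] E.
  have := dec c a (lt_trans r0 rc) (ltW ca) ab; nra.
- have [z|z|c] := @MVT R f df a r ar; [|exact: cont|].
    by rewrite in_itv/= => /andP[? ?]; apply: fd; rewrite (lt_trans a0)//= (lt_trans _ rb).
  rewrite in_itv/= => /andP[ac cr] E.
  have := dec a c a0 (ltW ac) (lt_trans cr rb); nra.
Qed.

Lemma derive_le0_nincr (f df : R -> R) b :
  (forall u, 0 < u < b -> is_derive u 1 f (df u)) ->
  (forall u, 0 < u < b -> df u <= 0) ->
  forall u v, 0 < u -> u <= v -> v < b -> f v <= f u.
Proof.
move=> fd df0 u v u0 uv vb.
have [z||c] := @MVT_segment R f df u v uv.
- rewrite in_itv/= => /andP[uz zv].
  by apply: fd; rewrite (lt_trans u0 uz)//= (lt_trans zv).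
- apply: derivable_within_continuous => z; rewrite in_itv/= => /andP[uz zv].
  by apply: ex_derive; apply: fd; rewrite (lt_le_trans u0 uz) (le_lt_trans zv vb).
rewrite in_itv/= => /andP[uc cv] E.
have : df c <= 0 by apply: df0; rewrite (lt_le_trans u0 uc)/= (le_lt_trans cv).
nra.
Qed.

Lemma sin_le r : 0 <= r -> sin r <= r.
Proof.
rewrite le_eqVlt => /predU1P[<-|r0]; first by rewrite sin0.
have D u : is_derive u 1 (fun x => x - sin x) (1 - cos u) by exact: is_deriveB.
have [|c _] := @MVT R _ (fun x => 1 - cos x) 0 r r0 (fun u _ => D u).
  by apply: continuous_subspaceT => y; apply: continuousB => //; exact: continuous_sin.
rewrite sin0 !subr0 => E.
by have := cos_le1 c; nra.
Qed.

(** The difference sin r - r cos r vanishes at 0 and has derivative r sin r. *)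
Lemma sin_gt_rcos r : 0 < r < pi -> r * cos r < sin r.
Proof.
move=> /andP[r0 rpi].
have D u : is_derive u 1 (fun x => sin x - x * cos x) (u * sin u).
  apply: is_derive_eq; rewrite /GRing.scale/=; ring.
have [|c] := @MVT R _ (fun x => x * sin x) 0 r r0 (fun u _ => D u).
  apply: continuous_subspaceT => y; apply: differentiable_continuous.
  by apply/derivable1_diffP; apply: ex_derive; exact: D.
rewrite in_itv/= => /andP[c0 cr]; rewrite sin0 mul0r !subr0 => E.
have sc : 0 < sin c by apply: sin_gt0_pi; rewrite c0 (lt_trans cr).
have := mulr_gt0 (mulr_gt0 c0 sc) r0; lra.
Qed.

Definition rcot r : R := if r == 0 then 1 else r * cos r / sin r.
Definition sinc r : R := if r == 0 then 1 else sin r / r.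

Lemma is_derive_cot r : sin r != 0 ->
  is_derive r 1 (fun x => cos x / sin x) (- (sin r ^+ 2)^-1).
Proof.
move=> s0; have V := is_deriveV s0 (is_derive_sin r).
apply: is_derive_eq; rewrite /GRing.scale/=.
have := cos2Dsin2 r; move: s0; set s := sin r; set c := cos r => s0 E.
by transitivity (- (c ^+ 2 + s ^+ 2) / s ^+ 2); [field | rewrite E mulN1r].
Qed.

Lemma rcotE r : r != 0 -> rcot r = r * (cos r / sin r).
Proof. by rewrite /rcot => /negPf ->; rewrite mulrA. Qed.

Lemma rcot0 : rcot 0 = 1. Proof. by rewrite /rcot eqxx. Qed.
Lemma sinc0 : sinc 0 = 1. Proof. by rewrite /sinc eqxx. Qed.

Lemma rcot_le1 r : 0 <= r < pi -> rcot r <= 1.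
Proof.
move=> /andP[]; rewrite le_eqVlt => /predU1P[<-|r0] rpi; first by rewrite rcot0.
have s0 : 0 < sin r by apply: sin_gt0_pi; rewrite r0.
by rewrite rcotE ?gt_eqF// mulrA ler_pdivrMr// mul1r ltW// sin_gt_rcos// r0.
Qed.

Lemma sinc_gt0 r : 0 <= r < pi -> 0 < sinc r.
Proof.
move=> /andP[]; rewrite le_eqVlt => /predU1P[<-|r0] rpi; first by rewrite sinc0.
by rewrite /sinc gt_eqF// divr_gt0// sin_gt0_pi// r0.
Qed.

Lemma sinc_le1 r : 0 <= r -> sinc r <= 1.
Proof.
rewrite le_eqVlt => /predU1P[<-|r0]; first by rewrite sinc0.
by rewrite /sinc gt_eqF// ler_pdivrMr// mul1r sin_le// ltW.
Qed.

Lemma sincE r : sinc r * r = sin r.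
Proof.
rewrite /sinc; case: eqVneq => [->|r0]; first by rewrite mulr0 sin0.
by rewrite divfK.
Qed.

(** Jensen's inequality for a function on [0, b[ with nonincreasing supporting
    lines. It is stated for r below the convex combination because r will be
    the norm of a convex combination of vectors. No supporting line is asked
    for at 0, where maximality is enough: the functions below are extended
    there by their limits. *)
Lemma jensen_of_tangent (f : R -> R) b :
  (forall r, 0 <= r < b -> f r <= f 0) ->
  (forall a, 0 < a < b -> exists2 d, d <= 0 &
     forall r, 0 <= r < b -> f r <= f a + d * (r - a)) ->
  forall t r0 r1 r, 0 <= t <= 1 -> 0 <= r0 < b -> 0 <= r1 < b -> 0 <= r < b ->
    r <= (1 - t) * r0 + t * r1 -> (1 - t) * f r0 + t * f r1 <= f r.
Proof.
move=> f0 ft t r0 r1 r /andP[t0 t1] r0b r1b /andP[+ rb] rle.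
have t1' : 0 <= 1 - t by rewrite subr_ge0.
rewrite le_eqVlt => /predU1P[r_eq|rpos].
  rewrite -r_eq; have := ler_wpM2l t1' (f0 _ r0b).
  by have := ler_wpM2l t0 (f0 _ r1b); lra.
have [|d d0 dle] := ft r; first by rewrite rpos.
have := ler_wpM2l t1' (dle _ r0b); have := ler_wpM2l t0 (dle _ r1b).
have : 0 <= - d * ((1 - t) * r0 + t * r1 - r) by rewrite mulr_ge0 ?oppr_ge0// subr_ge0.
nra.
Qed.

(** The second derivative of r cot r is 2 (r cos r - sin r) / sin^3 r < 0 and
    the first one is (sin r cos r - r) / sin^2 r <= 0. *)
Lemma rcot_concave t r0 r1 r : 0 <= t <= 1 ->
  0 <= r0 < pi -> 0 <= r1 < pi -> 0 <= r < pi ->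
  r <= (1 - t) * r0 + t * r1 ->
  (1 - t) * rcot r0 + t * rcot r1 <= rcot r.
Proof.
apply: jensen_of_tangent; first by move=> u hu; rewrite rcot0; exact: rcot_le1.
move=> a api; have /andP[a0 _] := api.
pose f u : R := u * (cos u / sin u); pose df u : R := cos u / sin u - u / sin u ^+ 2.
have s0 u : 0 < u < pi -> sin u != 0 by move=> /sin_gt0_pi/lt0r_neq0.
have fd u : 0 < u < pi -> is_derive u 1 f (df u).
  move=> hu; have D := is_derive_cot (s0 _ hu).
  rewrite /f; apply: is_derive_eq; rewrite /GRing.scale/= /df; field; exact: s0.
have ddf u : 0 < u < pi ->
    is_derive u 1 df (2 * (u * cos u - sin u) / sin u ^+ 3).
  move=> hu; have D := is_derive_cot (s0 _ hu).
  have V : is_derive u 1 (fun x => (sin x ^+ 2)^-1) (- 2 * cos u / sin u ^+ 3).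
    apply: (is_derive_eq (@is_deriveV _ (fun x => sin x ^+ 2) u _ 1 (expf_neq0 2 (s0 _ hu)) _)); rewrite /GRing.scale/=; field; exact: s0.
  rewrite /df; apply: is_derive_eq; rewrite /GRing.scale/=; field; exact: s0.
have dec := derive_le0_nincr ddf.
have {}dec : forall u v, 0 < u -> u <= v -> v < pi -> df v <= df u.
  apply: dec => u hu; rewrite pmulr_lle0 ?invr_gt0 ?exprn_gt0 ?sin_gt0_pi//.
  by have := sin_gt_rcos hu; lra.
exists (df a).
  have sa : 0 < sin a by exact: sin_gt0_pi.
  rewrite /df (_ : _ - _ = (sin a * cos a - a) / sin a ^+ 2); last by field; exact: s0.
  rewrite pmulr_lle0 ?invr_gt0 ?exprn_gt0//.
  by have := sin_le (ltW a0); have := cos_le1 a; nra.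
move=> r' /andP[]; rewrite le_eqVlt => /predU1P[<-|r'0] r'pi.
  rewrite rcot0 rcotE ?gt_eqF// sub0r /df.
  (* the supporting line at a takes the value (a / sin a)^2 >= 1 at 0 *)
  have -> : a * (cos a / sin a) + (cos a / sin a - a / sin a ^+ 2) * - a
            = a ^+ 2 / sin a ^+ 2 by field; exact: s0.
  have sa : 0 < sin a by exact: sin_gt0_pi.
  have := sin_le (ltW a0); rewrite ler_pdivlMr ?exprn_gt0// mul1r; nra.
rewrite !rcotE ?gt_eqF//.
by apply: (concave_tangent_le fd dec) => //; rewrite r'0.
Qed.

(** The first and second derivatives of ln (sin r / r) are cot r - 1/r <= 0
    and 1/r^2 - 1/sin^2 r <= 0. *)
Lemma ln_sinc_concave t r0 r1 r : 0 <= t <= 1 ->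
  0 <= r0 < pi -> 0 <= r1 < pi -> 0 <= r < pi ->
  r <= (1 - t) * r0 + t * r1 ->
  (1 - t) * ln (sinc r0) + t * ln (sinc r1) <= ln (sinc r).
Proof.
apply: (@jensen_of_tangent (fun r => ln (sinc r))).
  move=> u /andP[u0 upi]; rewrite sinc0 ln1 ln_le0// sinc_le1//.
move=> a api; have /andP[a0 _] := api.
pose f u : R := ln (sin u) - ln u; pose df u : R := cos u / sin u - u^-1.
have s0 u : 0 < u < pi -> sin u != 0 by move=> /sin_gt0_pi/lt0r_neq0.
have fd u : 0 < u < pi -> is_derive u 1 f (df u).
  move=> hu; have /andP[u0 _] := hu.
  have D := is_derive1_comp (is_derive1_ln (sin_gt0_pi hu)) (is_derive_sin u).
  have D' := is_derive1_ln u0.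
  by apply: (is_derive_eq (is_deriveB D D')); rewrite /df mulrC.
have ddf u : 0 < u < pi -> is_derive u 1 df ((u ^+ 2)^-1 - (sin u ^+ 2)^-1).
  move=> hu; have D := is_derive_cot (s0 _ hu); have /andP[u0 _] := hu.
  have V := @is_deriveV _ id u _ 1 (lt0r_neq0 u0) (is_derive_id u 1).
  apply: (is_derive_eq (is_deriveB D V)); rewrite /GRing.scale/= mulr1.
  by rewrite opprK addrC.
have {}dec := derive_le0_nincr ddf.
have {}dec : forall u v, 0 < u -> u <= v -> v < pi -> df v <= df u.
  apply: dec => u hu; have /andP[u0 _] := hu.
  rewrite subr_le0 lef_pV2 ?posrE ?exprn_gt0 ?sin_gt0_pi//.
  have su : 0 < sin u by exact: sin_gt0_pi.
  by have := sin_le (ltW u0); nra.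
have fE u : 0 < u < pi -> ln (sinc u) = f u.
  move=> hu; have /andP[u0 _] := hu.
  by rewrite /sinc gt_eqF// ln_div ?posrE// sin_gt0_pi.
have sa : 0 < sin a by exact: sin_gt0_pi.
exists (df a).
  rewrite /df (_ : _ - _ = (a * cos a - sin a) / (sin a * a)); last first.
    by field; rewrite s0//= gt_eqF.
  rewrite pmulr_lle0 ?invr_gt0 ?mulr_gt0//.
  by have := sin_gt_rcos api; lra.
move=> r' /andP[]; rewrite le_eqVlt => /predU1P[<-|r'0] r'pi; last first.
  by rewrite !fE ?r'0//; apply: (concave_tangent_le fd dec) => //; rewrite r'0.
rewrite sinc0 ln1 fE// sub0r.
(* At 0 the supporting line condition reads f a - a (cot a - 1/a) >= 0. It
   follows from ln t >= 1 - 1/t and a (1 + cos a) <= 2 sin a, the half-angle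
   form of (a/2) cot (a/2) <= 1. *)
have L : f a >= 1 - a / sin a.
  have : ln (a / sin a) <= a / sin a - 1.
    have /le_ln1Dx : -1 < a / sin a - 1 by have := divr_gt0 a0 sa; lra.
    by rewrite addrC subrK.
  by rewrite ln_div ?posrE// /f; lra.
suff : a * (1 + cos a) <= 2 * sin a.
  rewrite -ler_pdivrMr// /df => h.
  have := lerD L h; rewrite -subr_ge0 => h'; rewrite -subr_ge0.
  apply: le_trans h' _; rewrite le_eqVlt; apply/orP; left; apply/eqP.
  by field; rewrite s0//= gt_eqF.
have hpi : 0 < a / 2 < pi by case/andP: api => ? ?; apply/andP; split; have := @pi_gt0 R; lra.
have := sin_gt_rcos hpi.
have sh := sin_gt0_pi hpi.
have E : a = (a / 2) *+ 2 by rewrite -mulr_natr divfK.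
have := sin_mulr2n (a / 2); have := cos_mulr2n (a / 2); rewrite -E.
have ch : 0 < cos (a / 2) by apply: cos_gt0_pihalf; case/andP: api => ? ?; lra.
set c := cos (a / 2) in ch *; set s := sin (a / 2) => -> -> h.
have := mulr_gt0 ch (_ : 0 < s - a / 2 * c); rewrite subr_gt0 => /(_ h) h'.
by rewrite -(mulr_natr (c ^+ 2)) -(mulr_natr (c * s)); nra.
Qed.

End OneVar.

(** * Concavity of the Hessian of the cost *)

Section CostHessian.
Variable R : realType.

(** The Hessian at x of c(., exp_x v) on the unit sphere, evaluated at a tangent
    vector w: the eigenvalue is 1 along v and r cot r on its orthogonal, with
    r = |v|. At v = 0 the second term vanishes and the first is |w|^2. *)
Definition hess_cost m (v : 'rV[R]_m) (w : 'rV[R]_m) : R :=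
  rcot (enorm v) * dotv w w
  + (1 - rcot (enorm v)) / enorm v ^+ 2 * dotv v w ^+ 2.

(** The Gram determinant of v and w, as a quadratic form in v. It measures how
    far the Hessian of the cost is from |w|^2; see [hess_costE]. *)
Definition gram m (w v : 'rV[R]_m) : R := dotv w w * dotv v v - dotv v w ^+ 2.

Lemma gram_ge0 m (w v : 'rV[R]_m) : 0 <= gram w v.
Proof. by rewrite subr_ge0 mulrC dotv_cauchy. Qed.

Lemma gramZ m (w v : 'rV[R]_m) a : gram w (a *: v) = a ^+ 2 * gram w v.
Proof. rewrite /gram !dotvZl !dotvZr; ring. Qed.

(** A nonnegative quadratic form divided by a positive number is jointly convex
    (the perspective of a convex function) and decreasing in the denominator. *)
Lemma gram_perspective m (w v0 v1 : 'rV[R]_m) (u0 u1 u t : R) :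
  0 <= t <= 1 -> 0 < u0 -> 0 < u1 -> 0 < u -> (1 - t) * u0 + t * u1 <= u ->
  gram w ((1 - t) *: v0 + t *: v1) / u
    <= (1 - t) * (gram w v0 / u0) + t * (gram w v1 / u1).
Proof.
move=> /andP[t0 t1] u00 u10 upos ule.
(* p is the point of contact: the form N = gram w satisfies
   N x / c >= 2 b x p - c N p, with equality at x = v, c = u. *)
set v := _ + _; have [p pE] : exists p, p = u^-1 *: v by exists (u^-1 *: v).
pose b (x y : 'rV[R]_m) := dotv w w * dotv x y - dotv x w * dotv y w.
have tangent (x : 'rV[R]_m) c : 0 < c -> 2 * b x p - c * gram w p <= gram w x / c.
  move=> c0; rewrite ler_pdivlMr// -subr_ge0.
  apply: le_trans (gram_ge0 w (x - c *: p)) _.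
  rewrite le_eqVlt; apply/orP; left; apply/eqP.
  by rewrite /gram /b !(dotvBl, dotvBr, dotvZl, dotvZr) (dotvC p x); ring.
have E : gram w v / u = 2 * ((1 - t) * b v0 p + t * b v1 p) - u * gram w p.
  have -> : (1 - t) * b v0 p + t * b v1 p = b v p.
    rewrite /b /v !(dotvDl, dotvZl); ring.
  rewrite pE gramZ /b dotvZr dotvZl /gram; field; exact: lt0r_neq0.
rewrite E.
have t1' : 0 <= 1 - t by rewrite subr_ge0.
have := ler_wpM2l t1' (tangent v0 _ u00); have := ler_wpM2l t0 (tangent v1 _ u10).
have := ler_wpM2r (gram_ge0 w p) ule.
lra.
Qed.

(** The half-angle formula for the cotangent; the quotient is
    (r/2) tan (r/2) when r > 0. *)
Lemma rcot_double (r : R) : 0 <= r < pi ->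
  rcot r = rcot (r / 2) - (r / 2) ^+ 2 / rcot (r / 2).
Proof.
move=> /andP[]; rewrite le_eqVlt => /predU1P[<-|r0] rpi.
  by rewrite !mul0r rcot0 expr0n mul0r subr0.
have hpi : 0 < r / 2 < pi by apply/andP; split; have := @pi_gt0 R; lra.
have sh := sin_gt0_pi hpi.
have ch : 0 < cos (r / 2) by apply: cos_gt0_pihalf; lra.
have E : r = (r / 2) *+ 2 by rewrite -mulr_natr divfK.
have h0 : r / 2 != 0 by rewrite gt_eqF//; lra.
rewrite (rcotE h0) (rcotE (lt0r_neq0 r0)).
have := sin_mulr2n (r / 2); have := cos_mulr2n (r / 2); rewrite -E => -> ->.
have := cos2Dsin2 (r / 2).
rewrite -(mulr_natr (cos _ ^+ 2)) -(mulr_natr (cos _ * sin _)).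
set c := cos _ in ch *; set s := sin _ in sh *.
move=> cs.
transitivity (r * (2 * c ^+ 2 - (c ^+ 2 + s ^+ 2)) / (2 * c * s)).
  by rewrite cs; field; rewrite !gt_eqF.
by field; rewrite !gt_eqF.
Qed.

Lemma rcot_gt0 (r : R) : 0 <= r < pi / 2 -> 0 < rcot r.
Proof.
move=> /andP[]; rewrite le_eqVlt => /predU1P[<-|r0] rpi; first by rewrite rcot0.
rewrite rcotE ?gt_eqF// mulr_gt0// divr_gt0//.
  by apply: cos_gt0_pihalf; lra.
by apply: sin_gt0_pihalf; rewrite r0.
Qed.

Lemma cos_ge_quadratic (r : R) : 0 <= r < pi / 2 -> 1 - r ^+ 2 / 2 <= cos r.
Proof.
move=> /andP[r0 rpi].
have E : r = (r / 2) *+ 2 by rewrite -mulr_natr divfK.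
have := cos_mulr2n (r / 2); rewrite -E => ->; rewrite cos2sin2 -(mulr_natr (1 - _)).
have h0 : 0 <= r / 2 by lra.
have s0 : 0 <= sin (r / 2) by apply: sin_ge0_pi; have := @pi_gt0 R; lra.
by have := sin_le h0; nra.
Qed.

Lemma rcot_ge (r : R) : 0 <= r < pi / 2 -> 1 - r ^+ 2 / 2 <= rcot r.
Proof.
move=> hr; have /andP[+ rpi] := hr.
rewrite le_eqVlt => /predU1P[r_eq|r0]; first by rewrite -r_eq rcot0; lra.
have sr : 0 < sin r by apply: sin_gt0_pihalf; rewrite r0.
have cr : 0 < cos r by apply: cos_gt0_pihalf; lra.
apply: le_trans (cos_ge_quadratic hr) _.
rewrite rcotE ?gt_eqF// mulrA ler_pdivlMr// mulrC ler_wpM2r ?(ltW cr)//.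
exact/sin_le/ltW.
Qed.

Lemma hess_costE m (v w : 'rV[R]_m) :
  hess_cost v w = dotv w w - (1 - rcot (enorm v)) / enorm v ^+ 2 * gram w v.
Proof.
rewrite /hess_cost /gram -enorm_sq.
have [v0|v0] := eqVneq (enorm v) 0.
  by rewrite v0 rcot0 subrr !mul0r subr0 mul1r addr0.
by rewrite -(enorm_sq v); field.
Qed.

(** The step that makes concavity provable by halving: the difference between the
    form at v and the form at v/2 is minus a quadratic form over a concave
    positive function of v/2. Positivity of r/2 cot (r/2) is why one halving
    brings the ball of radius pi into the range where the perspective argument
    applies. *)
Lemma hess_cost_half m (v w : 'rV[R]_m) : enorm v < pi ->
  hess_cost v w = hess_cost (2^-1 *: v) w
    - gram w (2^-1 *: v) / rcot (enorm (2^-1 *: v)).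
Proof.
move=> vpi; rewrite !hess_costE enormZ gramZ ger0_norm ?invr_ge0// mulrC.
rewrite (mulrC 2^-1) (rcot_double (r := enorm v)) ?enorm_ge0//.
have : rcot (enorm v / 2) != 0.
  by rewrite gt_eqF// rcot_gt0// divr_ge0 ?enorm_ge0//=; lra.
have [v0|v0] := eqVneq (enorm v) 0.
  have -> : gram w v = 0.
    have /eqP -> : v == 0 by rewrite -enorm_eq0 v0.
    by rewrite /gram !dot0v; ring.
  by move=> _; rewrite !(mulr0,mul0r) !subr0.
by move=> c0; field; rewrite ?c0 ?v0.
Qed.

Lemma hess_cost_le m (v w : 'rV[R]_m) : enorm v < pi -> hess_cost v w <= dotv w w.
Proof.
move=> vpi; rewrite hess_costE gerBl mulr_ge0 ?gram_ge0// divr_ge0 ?sqr_ge0//.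
by rewrite subr_ge0 rcot_le1// enorm_ge0.
Qed.

Lemma hess_cost_ge m (v w : 'rV[R]_m) : enorm v < pi / 2 ->
  dotv w w - enorm v ^+ 2 / 2 * dotv w w <= hess_cost v w.
Proof.
move=> vpi; rewrite /hess_cost.
have r1 : rcot (enorm v) <= 1.
  by rewrite rcot_le1// enorm_ge0/=; have := @pi_gt0 R; lra.
have := ler_wpM2r (dotv_ge0 w) (rcot_ge (r := enorm v) _).
rewrite enorm_ge0/= => /(_ vpi).
have : 0 <= (1 - rcot (enorm v)) / enorm v ^+ 2 * dotv v w ^+ 2.
  by rewrite mulr_ge0 ?sqr_ge0// divr_ge0 ?sqr_ge0// subr_ge0.
lra.
Qed.

Lemma enorm_conv m (v0 v1 : 'rV[R]_m) t : 0 <= t <= 1 ->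
  enorm ((1 - t) *: v0 + t *: v1) <= (1 - t) * enorm v0 + t * enorm v1.
Proof.
move=> /andP[t0 t1]; rewrite (le_trans (enormD _ _))// !enormZ !ger0_norm ?subr_ge0//.
Qed.

Lemma enorm_conv_lt m (v0 v1 : 'rV[R]_m) t b : 0 <= t <= 1 ->
  enorm v0 < b -> enorm v1 < b -> enorm ((1 - t) *: v0 + t *: v1) < b.
Proof.
move=> t01 h0 h1; apply: le_lt_trans (enorm_conv _ _ t01) _.
case/andP: t01 => t0 t1.
have t1' : 0 <= 1 - t by rewrite subr_ge0.
have := ler_wpM2l t1' (ltW h0); have := ler_wpM2l t0 (ltW h1).
have [->|tn] := eqVneq t 0; first lra.
have : 0 < t by rewrite lt_neqAle eq_sym tn.
nra.
Qed.

Definition hess_gap m (w : 'rV[R]_m) t (x0 x1 : 'rV[R]_m) :=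
  hess_cost ((1 - t) *: x0 + t *: x1) w
    - (1 - t) * hess_cost x0 w - t * hess_cost x1 w.

(** The half-angle step changes the form by a concave term, so that halving can
    only lower the gap. *)
Lemma hess_gap_half m (w v0 v1 : 'rV[R]_m) t : 0 <= t <= 1 ->
  enorm v0 < pi -> enorm v1 < pi ->
  hess_gap w t (2^-1 *: v0) (2^-1 *: v1) <= hess_gap w t v0 v1.
Proof.
move=> t01 h0 h1; rewrite /hess_gap.
have hv := enorm_conv_lt t01 h0 h1.
have hl (v : 'rV[R]_m) : enorm v < pi -> 0 <= enorm (2^-1 *: v) < pi / 2.
  by move=> ?; rewrite enorm_ge0/= enormZ ger0_norm ?invr_ge0//; lra.
have hl' (v : 'rV[R]_m) : enorm v < pi -> 0 <= enorm (2^-1 *: v) < pi.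
  by move=> /hl/andP[-> /=]; have := @pi_gt0 R; lra.
rewrite (hess_cost_half w h0) (hess_cost_half w h1) (hess_cost_half w hv).
have E : (1 - t) *: (2^-1 *: v0) + t *: (2^-1 *: v1) =
  2^-1 *: ((1 - t) *: v0 + t *: v1).
  by rewrite scalerDr !scalerA (mulrC 2^-1) (mulrC 2^-1).
rewrite E; have := @gram_perspective m w (2^-1 *: v0) (2^-1 *: v1)
  (rcot (enorm (2^-1 *: v0))) (rcot (enorm (2^-1 *: v1)))
  (rcot (enorm (2^-1 *: ((1 - t) *: v0 + t *: v1)))) t t01.
rewrite E => /(_ (rcot_gt0 (hl _ h0)) (rcot_gt0 (hl _ h1)) (rcot_gt0 (hl _ hv))).
have -> : (1 - t) * rcot (enorm (2^-1 *: v0)) + t * rcot (enorm (2^-1 *: v1))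
    <= rcot (enorm (2^-1 *: ((1 - t) *: v0 + t *: v1))).
  by apply: rcot_concave => //; rewrite ?hl'// -E enorm_conv.
move=> /(_ isT); lra.
Qed.

Lemma exp_half_le k : 2^-1 ^+ k.+1 <= 2^-1 :> R.
Proof.
rewrite exprS ler_piMr ?invr_ge0//; elim: k => [|k IH]; first by rewrite expr0.
by rewrite exprS; lra.
Qed.

Lemma exp_half_small (c e : R) : 0 < e -> exists k, 2^-1 ^+ k.+1 * c < e.
Proof.
move=> e0; exists (Num.bound (`|c| / e)); set k := Num.bound _.
have kb : `|c| / e < k%:R by apply: archi_boundP; rewrite divr_ge0// ltW.
have k2 : (k%:R : R) <= 2 ^+ k.+1 by rewrite -natrX ler_nat ltnW// ltnW// ltn_expl.
rewrite exprVn mulrC ltr_pdivrMr ?exprn_gt0//.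
apply: le_lt_trans (ler_norm c) _; rewrite mulrC -ltr_pdivrMr//.
exact: lt_le_trans kb k2.
Qed.

(** The gap is at least its value after k halvings, which is bounded below by
    - |v_t|^2 |w|^2 / (2 4^k): after halving, the forms at the two ends are at
    most |w|^2 and the form at v_t is close to |w|^2. *)
Lemma hess_cost_concave m (w v0 v1 : 'rV[R]_m) t : 0 <= t <= 1 ->
  enorm v0 < pi -> enorm v1 < pi ->
  (1 - t) * hess_cost v0 w + t * hess_cost v1 w
    <= hess_cost ((1 - t) *: v0 + t *: v1) w.
Proof.
move=> t01 h0 h1.
pose D := hess_gap w t; have pp := @pi_gt0 R.
have hk k (v : 'rV[R]_m) : enorm v < pi -> enorm (2^-1 ^+ k *: v) < pi.
  move=> vpi; rewrite enormZ ger0_norm ?exprn_ge0 ?invr_ge0//.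
  apply: le_lt_trans vpi; apply: ler_piMl; first exact: enorm_ge0.
  by rewrite exprn_ile1// ?invr_ge0//; lra.
have Dk k : D (2^-1 ^+ k *: v0) (2^-1 ^+ k *: v1) <= D v0 v1.
  elim: k => [|k]; first by rewrite expr0 !scale1r.
  apply: le_trans; rewrite exprS -!scalerA.
  by apply: hess_gap_half => //; exact: hk.
rewrite -subr_ge0 opprD addrA -/(D v0 v1) leNgt; apply/negP => D0.
set v := (1 - t) *: v0 + t *: v1; have hv := enorm_conv_lt t01 h0 h1.
have [|k] := @exp_half_small (pi ^+ 2 * dotv w w) (- D v0 v1).
  by rewrite oppr_gt0.
have := exp_half_le k; have := Dk k.+1; have := hk k.+1.
have : 0 < 2^-1 ^+ k.+1 :> R by rewrite exprn_gt0 ?invr_gt0.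
move: (2^-1 ^+ k.+1) => q q0 hq + qle qsmall.
rewrite leNgt => /negP; apply.
have E : (1 - t) *: (q *: v0) + t *: (q *: v1) = q *: v.
  by rewrite /v scalerDr !scalerA (mulrC q) (mulrC q).
rewrite [X in _ < X]/D /hess_gap E.
have nq : enorm (q *: v) = q * enorm v by rewrite enormZ gtr0_norm.
have vge := enorm_ge0 v.
have := @hess_cost_ge m (q *: v) w; rewrite nq.
have -> : q * enorm v < pi / 2.
  apply: (@le_lt_trans _ _ (2^-1 * enorm v)); first exact: ler_wpM2r.
  by rewrite mulrC ltr_pM2r ?invr_gt0.
move=> /(_ isT).
have := hess_cost_le w (hq _ h0); have := hess_cost_le w (hq _ h1).
case/andP: t01 => t0 t1.
have t1' : 0 <= 1 - t by rewrite subr_ge0.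
move=> /(ler_wpM2l t0) a1 /(ler_wpM2l t1') a2 a3.
have : (q * enorm v) ^+ 2 / 2 * dotv w w <= q * (pi ^+ 2 * dotv w w).
  rewrite [leRHS]mulrA ler_wpM2r ?dotv_ge0//.
  have v2 : enorm v ^+ 2 <= pi ^+ 2.
    by rewrite ler_pXn2r ?nnegrE ?enorm_ge0 ?(ltW pp)// ltW.
  have q2 : q ^+ 2 <= q by rewrite expr2 ler_piMl ?(ltW q0)//; lra.
  apply: (@le_trans _ _ ((q * enorm v) ^+ 2)).
    by rewrite ler_pdivrMr// ler_peMr ?sqr_ge0//; lra.
  by rewrite exprMn; apply: ler_pM => //; exact: sqr_ge0.
move: qsmall; rewrite /D; lra.
Qed.

End CostHessian.

(** * Frames of the sphere and Jacobian determinants *)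

Section Frames.
Variable R : realType.

Lemma tr_rowvec m (u v : 'rV[R]_m) : u *m v^T = (dotv u v)%:M.
Proof. by rewrite [LHS]mx11_scalar. Qed.

(** Sylvester's identity, from two block triangular factorizations of the matrix
    with blocks s, -U, V, 1. *)
Lemma det_scalar_add_mul m k (s : R) (U : 'M[R]_(m, k)) (V : 'M[R]_(k, m)) :
  s != 0 ->
  s ^+ k * \det (s%:M + U *m V) = s ^+ m * \det (s%:M + V *m U).
Proof.
move=> s0; pose X := block_mx (s%:M : 'M[R]_m) (- U) V (1%:M : 'M[R]_k).
have E1 : \det X = \det (s%:M + U *m V).
  have -> : \det X = \det (block_mx 1%:M U 0 1%:M *m X).
    by rewrite det_mulmx det_ublock !det1 !mul1r.
  rewrite mulmx_block !mul1mx !mul0mx !add0r mulmx1 addNr.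
  by rewrite det_lblock det1 mulr1.
have E2 : \det X = s ^+ m * \det (1%:M + s^-1 *: (V *m U)).
  have -> : X = block_mx 1%:M 0 (s^-1 *: V) 1%:M *m
                block_mx s%:M (- U) 0 (1%:M + s^-1 *: (V *m U)).
    rewrite mulmx_block !mul1mx !mul0mx ?mulmx0 !addr0 mul_mx_scalar scalerA divff//.
    by rewrite scale1r mulmxN -scalemxAl addrCA addNr addr0.
  by rewrite det_mulmx det_lblock det_ublock !det1 !mul1r det_scalar.
rewrite -E1 E2 mulrCA -detZ; congr (_ * \det _).
by rewrite scalerDr scalerA divff// scale1r scalemx1.
Qed.

Lemma det_orthonormal_pos m (C : 'M[R]_m) : C *m C^T = 1%:M -> 0 < \det C -> \det C = 1.
Proof.
move=> /(congr1 determinant); rewrite det_mulmx det_tr det1 -expr2 => /eqP.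
rewrite sqrf_eq1 => /orP[/eqP//|/eqP ->]; lra.
Qed.

Definition householder m (w : 'rV[R]_m) : 'M[R]_m :=
  1%:M - (2 / dotv w w) *: (w^T *m w).

Lemma householder_tr m (w : 'rV[R]_m) : (householder w)^T = householder w.
Proof.
rewrite /householder linearB/= linearZ/= trmx1 trmx_mul trmxK//.
Qed.

Lemma householder_orthogonal m (w : 'rV[R]_m) :
  householder w *m (householder w)^T = 1%:M.
Proof.
rewrite householder_tr /householder.
have [->|w0] := eqVneq w 0; first by rewrite mulmx0 scaler0 subr0 mulmx1.
rewrite mulmxBl mul1mx mulmxBr mulmx1 -scalemxAl -scalemxAr -mulmxA (mulmxA w) tr_rowvec.
rewrite mul_scalar_mx -scalemxAr !scalerA.
have -> : 2 / dotv w w * (2 / dotv w w * dotv w w) = 2 / dotv w w + 2 / dotv w w.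
  by field; rewrite dotv_eq0.
by rewrite scalerDl opprB addrK subrK.
Qed.

(** The reflection exchanging the first basis vector and x; when these are equal
    the quotient 2 / 0 = 0 makes the reflection the identity. *)
Lemma householder_delta m (x : 'rV[R]_m.+1) : dotv x x = 1 ->
  delta_mx 0 0 *m householder (delta_mx 0 0 - x) = x.
Proof.
move=> xx; set w := _ - x.
rewrite /householder mulmxBr mulmx1 -scalemxAr mulmxA tr_rowvec mul_scalar_mx scalerA.
have ww : dotv w w = 2 * (1 - x 0 0).
  rewrite /w dotvBl !dotvBr !(dotvC (delta_mx 0 0)) !dotv_delta xx mxE eqxx /=; ring.
have ew : dotv (delta_mx 0 0) w = 1 - x 0 0.
  by rewrite dotvC dotv_delta !mxE eqxx.
have [w0|w0] := eqVneq w 0.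
  by rewrite w0 scaler0 subr0; apply/eqP; rewrite -subr_eq0 -/w w0.
have x0 : 1 - x 0 0 != 0.
  by apply: contra_neq w0 => x0; apply/eqP; rewrite -dotv_eq0 ww x0 mulr0.
have -> : 2 / dotv w w * dotv (delta_mx 0 0) w = 1.
  by rewrite ww ew; field.
by rewrite scale1r /w opprB addrCA subrr addr0.
Qed.

Lemma orthonormal_completion n (x : 'rV[R]_n.+1) : dotv x x = 1 ->
  exists B : 'M[R]_(n, n.+1),
    (col_mx x B : 'M[R]_n.+1) *m (col_mx x B : 'M[R]_n.+1)^T = 1%:M.
Proof.
move=> xx; pose H : 'M[R]_(1 + n) := householder (delta_mx 0 0 - x).
exists (dsubmx H); have -> : col_mx x (dsubmx H) = H.
  rewrite -[RHS]vsubmxK; congr col_mx; rewrite -[LHS](householder_delta xx) -rowE.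
  by apply/rowP => j; rewrite [LHS]mxE [RHS]mxE; congr (H _ _); exact/val_inj.
exact: householder_orthogonal.
Qed.

Lemma col_mx_orthonormal n (x : 'rV[R]_n.+1) (B : 'M[R]_(n, n.+1)) :
  (col_mx x B : 'M[R]_n.+1) *m (col_mx x B : 'M[R]_n.+1)^T = 1%:M <->
  [/\ x *m x^T = 1%:M, x *m B^T = 0, B *m x^T = 0 & B *m B^T = 1%:M].
Proof.
rewrite (tr_col_mx (m1 := 1)) (mul_col_row (m1 := 1) (p1 := 1)).
rewrite [X in _ = X](scalar_mx_block 1 n 1); split.
  by move=> E; have [] := @eq_block_mx _ 1 n 1 n _ _ _ _ _ _ _ _ E.
by move=> [-> -> -> ->].
Qed.

(** A reflection provides an orthonormal matrix with first row x. If its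
    determinant is -1, the sign of the second row is changed, which requires a
    sphere of dimension at least one. *)
Lemma oframeP n (x : 'rV[R]_n.+2) : sphere x -> oriented_frame x (oframe x).
Proof.
move=> Sx; rewrite /oframe; case: xgetP => [B -> //|] /(_ _) noB; exfalso.
have xx : dotv x x = 1 by rewrite -enorm_sq Sx expr1n.
have [B] := orthonormal_completion xx.
set C := (col_mx x B : 'M[R]_n.+2) => CC.
have [xx1 xB Bx BB] := (col_mx_orthonormal x B).1 CC.
have tB (B' : 'M[R]_(n.+1, n.+2)) : B' *m x^T = 0 -> forall i, tangent x (row i B').
  move=> B'x i; rewrite /tangent/= dotvC /dotv -row_mul B'x.
  by rewrite !mxE.
have dC : \det C ^+ 2 = 1.
  by have := congr1 determinant CC; rewrite det_mulmx det_tr det1 -expr2.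
have [dpos|dneg] := ltP 0 (\det C); first by apply: (noB B); split => //; exact: tB.
(* reversal of the first vector of the frame *)
pose D : 'M[R]_(1 + n) := block_mx (-1)%:M 0 0 1%:M.
have DD : D *m D^T = 1%:M.
  rewrite /D tr_block_mx !tr_scalar_mx !trmx0 mulmx_block !(mulmx0,mul0mx) ?(addr0,add0r).
  by rewrite -!scalar_mxM mulrNN !mulr1 -scalar_mx_block.
have dD : \det D = -1 by rewrite /D det_lblock det_scalar1 det1 mulr1.
apply: (noB (D *m B)); split.
- by rewrite trmx_mul -mulmxA (mulmxA B) BB mul1mx.
- by apply: tB; rewrite -mulmxA Bx mulmx0.
have -> : (col_mx x (D *m B) : 'M[R]_n.+2) = (block_mx 1%:M 0 0 D : 'M[R]_(1 + n.+1)) *m C.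
  by rewrite /C (mul_block_col (m1 := 1) (n1 := 1)) !mul1mx !mul0mx addr0 add0r.
rewrite det_mulmx (@det_lblock R 1 n.+1) det1 mul1r dD mulN1r oppr_gt0 lt_neqAle dneg andbT.
by apply/eqP => d0; move: dC; rewrite d0 expr0n/= => /eqP; rewrite eq_sym oner_eq0.
Qed.

(** The block matrix whose first row is F x and whose other rows are the images
    of the frame, expressed in the frame completed by F x, is block triangular
    with the Jacobian matrix as a block. Both completed frames have
    determinant one, so that only the matrix M of the differential, completed
    by x |-> F x, is left. *)
Lemma sjacE n (F : 'rV[R]_n.+2 -> 'rV[R]_n.+2) (x : 'rV[R]_n.+2) (M : 'M[R]_n.+2) :
  sphere x -> sphere (F x) -> x *m M = F x ->
  (forall w, tangent x w -> sdiff F x w = w *m M) -> sjac F x = \det M.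
Proof.
move=> Sx Sy xM dM.
have [B1 B2 B3] := oframeP Sx; have [C1 C2 C3] := oframeP Sy.
rewrite /sjac; set B := oframe x in B1 B2 B3 *; set C := oframe (F x) in C1 C2 C3 *.
set y := F x in xM Sy C2 C3 *.
have ortho (z : 'rV[R]_n.+2) (A : 'M[R]_(n.+1, n.+2)) : sphere z ->
    A *m A^T = 1%:M -> (forall i, tangent z (row i A)) -> 0 < \det (col_mx z A : 'M[R]_n.+2) ->
    A *m z^T = 0 /\ \det (col_mx z A : 'M[R]_n.+2) = 1.
  move=> Sz AA Az Ad.
  have zA : A *m z^T = 0.
    apply/matrixP => i j; rewrite ord1 [RHS]mxE.
    by have := Az i; rewrite /tangent/= dotvC /dotv -row_mul mxE.
  split=> //; apply: det_orthonormal_pos => //; apply/col_mx_orthonormal; split => //.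
    by rewrite tr_rowvec -enorm_sq Sz expr1n.
  by apply: trmx_inj; rewrite trmx_mul trmxK zA trmx0.
have [_ dB] := ortho _ _ Sx B1 B2 B3; have [Cy dC] := ortho _ _ Sy C1 C2 C3.
have -> : \matrix_(i, j) dotv (row i C) (sdiff F x (row j B)) = C *m (B *m M)^T.
  apply/matrixP => i j; rewrite mxE (dM _ (B2 j)) /dotv -row_mul.
  rewrite !mxE; apply: eq_bigr => k _; rewrite !mxE; congr (_ * _).
  by apply: eq_bigr => l _; rewrite mxE.
transitivity (\det ((col_mx y C : 'M[R]_n.+2) *m ((col_mx x B : 'M[R]_n.+2) *m M)^T)).
  rewrite (mul_col_mx (m1 := 1) x) xM (tr_col_mx (m1 := 1)).
  rewrite (mul_col_row (m1 := 1) (p1 := 1)) Cy (@det_ublock R 1 n.+1) tr_rowvec -enorm_sq Sy.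
  by rewrite expr1n det1 mul1r.
by rewrite det_mulmx det_tr det_mulmx dB dC !mul1r.
Qed.

Lemma det_block_scalar11 (a b c d : R) :
  \det (block_mx a%:M b%:M c%:M d%:M : 'M[R]_(1 + 1)) = a * d - b * c.
Proof.
set M := block_mx _ _ _ _.
have e0 : 0 = @lshift 1 1 0 :> 'I_2 by exact/val_inj.
have e1 : 1 = @rshift 1 1 0 :> 'I_2 by exact/val_inj.
have M00 : M 0 0 = a by rewrite e0 block_mxEul mxE eqxx.
have M01 : M 0 1 = b by rewrite e0 e1 block_mxEur mxE eqxx.
have M10 : M 1 0 = c by rewrite e0 e1 block_mxEdl mxE eqxx.
have M11 : M 1 1 = d by rewrite e1 block_mxEdr mxE eqxx.
clearbody M; rewrite (expand_det_row _ 0) !big_ord_recl big_ord0 /cofactor.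
have -> : lift ord0 ord0 = 1 :> 'I_2 by exact/val_inj.
rewrite (mx11_scalar (row' 0 (col' 0 M))) (mx11_scalar (row' 0 (col' 1 M))) !det_scalar1.
rewrite !mxE.
have -> : lift 0 0 = 1 :> 'I_2 by exact/val_inj.
have -> : lift 1 0 = 0 :> 'I_2 by exact/val_inj.
by rewrite M00 M01 M10 M11 /=; ring.
Qed.

(** The matrix is s plus a matrix of rank two; Sylvester's identity reduces its
    determinant to that of the matrix with rows (c, s |v|^2) and (-s, c), which
    is 1. *)
Lemma det_rank2_update n (s c k : R) (x v : 'rV[R]_n.+2) :
  s != 0 -> dotv x x = 1 -> dotv x v = 0 -> c ^+ 2 + s ^+ 2 * dotv v v = 1 ->
  k * dotv v v = c - s ->
  \det (s%:M + (x^T *m ((c - s) *: x + s *: v) + v^T *m (k *: v - s *: x))) = s ^+ n.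
Proof.
move=> s0 xx xv cs kv.
pose U := row_mx x^T v^T; pose V := col_mx ((c - s) *: x + s *: v) (k *: v - s *: x).
have := det_scalar_add_mul U V s0.
rewrite /U /V mul_row_col mul_col_row !mulmxBl !mulmxDl -!scalemxAl !tr_rowvec.
rewrite (dotvC v x) xx xv !raddf0 ?scaler0 ?addr0 !scale_scalar_mx ?mulr1 ?add0r ?sub0r kv.
have E1 a b : a%:M + b%:M = (a + b)%:M :> 'M[R]_1 by rewrite raddfD.
have E2 a : - a%:M = (- a)%:M :> 'M[R]_1 by rewrite raddfN.
rewrite (scalar_mx_block 1 1) add_block_mx !add0r !E1 E2 det_block_scalar11.
have -> : (s + (c - s)) * (s + (c - s)) - s * dotv v v * - s = 1.
  by rewrite -[RHS]cs; ring.
by rewrite mulr1 => E; apply: (mulfI (expf_neq0 2 s0)); rewrite [LHS]E -exprD.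
Qed.
End Frames.

(** * Differential calculus of row vectors *)

Section Calculus.
Variable R : realType.

Lemma near0_dist (V : normedModType R) (P : set V) :
  (\forall h \near (0 : V), P h) -> exists2 r : R, 0 < r & forall h, `|h| < r -> P h.
Proof.
move=> /nbhs_ballP[r r0 Pr]; exists r => // h hr; apply: Pr.
by rewrite -ball_normE/= sub0r normrN.
Qed.

Lemma is_diff_littleo (V W : normedModType R) (f : V -> W) (L : {linear V -> W}) (x : V) :
  continuous L ->
  (forall e : R, 0 < e -> \forall h \near (0 : V), `|f (h + x) - f x - L h| <= e * `|h|) ->
  is_diff x f L.
Proof.
move=> cL fL.
have E : f \o shift x = cst (f x) + L +o_ 0 id.
  apply/eqaddoP => e e0; have := fL e e0; apply: filterS => h /=.
  by rewrite !fctE /= opprD addrA.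
have dE := diff_unique cL E.
by apply: DiffDef => //; apply/diff_locallyP; rewrite dE.
Qed.

Lemma near_eq_is_diff (V W : normedModType R) (f g : V -> W) (x : V) :
  (\forall z \near x, f z = g z) -> differentiable f x -> is_diff x g ('d f x).
Proof.
move=> fg df; apply: is_diff_littleo; first exact: diff_continuous.
move=> e e0.
have /eqaddoP/(_ e e0) := diff_locally df.
have : \forall h \near (0 : V), f (h + x) = g (h + x).
  by move: fg; rewrite (near_shift 0 x)/= ; apply: filterS => h /=; rewrite subr0.
apply: filterS2 => h fgh.
by rewrite !fctE/= -fgh -(nbhs_singleton fg) opprD addrA.
Qed.

(** The functions cos |w| and (sin |w| / |w|) w are compositions with |w|, which
    is not differentiable at 0; there, differentiability comes from this
    estimate instead of the chain rule. *)
Lemma is_diff_quadratic (V W : normedModType R) (f : V -> W) (L : {linear V -> W}) (x : V) (c : R) :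
  continuous L ->
  (\forall h \near (0 : V), `|f (h + x) - f x - L h| <= c * `|h| ^+ 2) ->
  is_diff x f L.
Proof.
move=> cL fL; apply: is_diff_littleo => // e e0.
have : \forall h \near (0 : V), `|h| < e / (`|c| + 1).
  by apply: nbhs0_lt; rewrite divr_gt0// ltr_pwDr.
move: fL; apply: filterS2 => h h1 h2; apply: (le_trans h1).
rewrite expr2 mulrA ler_wpM2r//.
move: h2; rewrite ltr_pdivlMr ?ltr_pwDr// => h2.
have := ler_norm c; have := normr_ge0 h; nra.
Qed.

Lemma is_derive_rowP m (M : R -> 'rV[R]_m) (dM : 'rV[R]_m) (s : R) :
  is_derive s 1 M dM <-> forall j, is_derive s 1 (fun t => M t 0 j) (dM 0 j).
Proof.
split=> [[dM1 dM2] j|h].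
  apply: DeriveDef; first exact: (derivable_mxP M s 1).1.
  by rewrite -dM2 derive_mx// mxE.
have dM1 : derivable M s 1.
  by apply/derivable_mxP => i j; rewrite ord1; exact: ex_derive.
apply: DeriveDef => //; rewrite derive_mx//; apply/rowP => j; rewrite mxE.
exact: derive_val.
Qed.

Lemma is_derive_scale m (k : R -> R) (u : R -> 'rV[R]_m) (dk : R) du (s : R) :
  is_derive s 1 k dk -> is_derive s 1 u du ->
  is_derive s 1 (fun t => k t *: u t) (dk *: u s + k s *: du).
Proof.
move=> hk /is_derive_rowP hu; apply/is_derive_rowP => j.
have D := hu j.
have -> : (fun t => (k t *: u t) 0 j) = (fun t => k t * u t 0 j).
  by apply/funext => t; rewrite mxE.
by apply: is_derive_eq; rewrite !mxE /GRing.scale/=; ring.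
Qed.

Lemma is_derive_dotv m (u v : R -> 'rV[R]_m) du dv (s : R) :
  is_derive s 1 u du -> is_derive s 1 v dv ->
  is_derive s 1 (fun t => dotv (u t) (v t)) (dotv du (v s) + dotv (u s) dv).
Proof.
move=> /is_derive_rowP hu /is_derive_rowP hv.
have -> : (fun t => dotv (u t) (v t)) = \sum_i (fun t => u t 0 i * v t 0 i).
  by apply/funext => t; rewrite dotvE fct_sumE.
have D i : is_derive s 1 (fun t => u t 0 i * v t 0 i) (du 0 i * v s 0 i + u s 0 i * dv 0 i).
  have Du := hu i; have Dv := hv i.
  by apply: is_derive_eq; rewrite /GRing.scale/=; ring.
apply: is_derive_eq.
by rewrite !dotvE -big_split.
Qed.

Lemma is_derive_diff_comp (V W : normedModType R) (c : R -> V) (f : V -> W) (s : R) dc :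
  differentiable f (c s) -> is_derive s 1 c dc ->
  is_derive s 1 (f \o c) ('d f (c s) dc).
Proof.
move=> df [/derivable1_diffP dcs <-].
have dfc : differentiable (f \o c) s by exact: differentiable_comp.
apply: DeriveDef; first exact/derivable1_diffP.
by rewrite !deriveE// diff_comp.
Qed.

Lemma differentiable_rowP (V : normedModType R) m (f : V -> 'rV[R]_m) x :
  (forall j, differentiable (fun z => f z 0 j) x) -> differentiable f x.
Proof.
move=> h; have -> : f = \sum_(j < m) (fun z => f z 0 j *: delta_mx 0 j).
  by apply/funext => z; rewrite fct_sumE [LHS]row_sum_delta.
by apply: differentiable_sum => j; apply: differentiableZl; exact: h.
Qed.

Lemma differentiable_entry (V : normedModType R) m (f : V -> 'rV[R]_m) x j :
  differentiable f x -> differentiable (fun z => f z 0 j) x.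
Proof.
by move=> df; exact: (differentiable_comp df (differentiable_coord (f x) 0 j)).
Qed.

Lemma differentiable_scale (V : normedModType R) m (k : V -> R) (f : V -> 'rV[R]_m) x :
  differentiable k x -> differentiable f x -> differentiable (fun z => k z *: f z) x.
Proof.
move=> dk df; apply: differentiable_rowP => j.
have -> : (fun z => (k z *: f z) 0 j) = (fun z => k z * f z 0 j).
  by apply/funext => t; rewrite mxE.
by apply: differentiableM => //; exact: differentiable_entry.
Qed.

Lemma differentiable_dotv (V : normedModType R) m (f g : V -> 'rV[R]_m) x :
  differentiable f x -> differentiable g x -> differentiable (fun z => dotv (f z) (g z)) x.
Proof.
move=> df dg.
have -> : (fun t => dotv (f t) (g t)) = \sum_i (fun t => f t 0 i * g t 0 i).
  by apply/funext => t; rewrite dotvE fct_sumE.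
by apply: differentiable_sum => j; apply: differentiableM; exact: differentiable_entry.
Qed.

Lemma differentiable_comp1 (V : normedModType R) (g : V -> R) (f : R -> R) x d :
  differentiable g x -> is_derive (g x) 1 f d -> differentiable (fun z => f (g z)) x.
Proof.
by move=> dg [/derivable1_diffP df _]; exact: (differentiable_comp dg df).
Qed.

End Calculus.

(** * The coefficients of the exponential map *)

Section SphereCalculus.
Variable R : realType.

Lemma norm_entry_le m (h : 'rV[R]_m) j : `|h 0 j| <= `|h|.
Proof.
rewrite [leRHS]/Num.Def.normr/= mx_normrE.
by apply: le_trans (le_bigmax _ _ (0, j)).
Qed.

Lemma dotv_le_norm m (h : 'rV[R]_m) : dotv h h <= m%:R * `|h| ^+ 2.
Proof.
rewrite dotvE -[m in m%:R]card_ord -sum1_card natr_sum mulr_suml.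
apply: ler_sum => i _; rewrite mul1r -expr2 -real_normK ?num_real//.
by rewrite lerXn2r ?nnegrE// norm_entry_le.
Qed.

Lemma enorm_near0 m (e : R) : 0 < e ->
  \forall h \near (0 : 'rV[R]_m), enorm h < e.
Proof.
move=> e0.
have : \forall h \near (0 : 'rV[R]_m), `|h| < e / (m%:R + 1).
  by apply: nbhs0_lt; rewrite divr_gt0// ltr_wpDl.
apply: filterS => h; rewrite ltr_pdivlMr ?ltr_wpDl// => he.
have m0 : 0 <= m%:R :> R by [].
rewrite -(ltr_pXn2r (n := 2)) ?nnegrE ?enorm_ge0 ?(ltW e0)// enorm_sq.
apply: le_lt_trans (dotv_le_norm h) _.
have h0 := normr_ge0 h.
apply: (@le_lt_trans _ _ ((`|h| * (m%:R + 1)) ^+ 2)); last first.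
  by rewrite ltr_pXn2r// ?nnegrE ?mulr_ge0 ?addr_ge0// ltW.
rewrite exprMn mulrC ler_wpM2l ?sqr_ge0//; nra.
Qed.

Definition cosn m (w : 'rV[R]_m) : R := cos (enorm w).
(** With [cosn], the two coefficients of the exponential map: exp_x w is
    cosn w x + sincn w. *)
Definition sincn m (w : 'rV[R]_m) : 'rV[R]_m := (sin (enorm w) / enorm w) *: w.

Lemma sincnE m (w : 'rV[R]_m) : sincn w = sinc (enorm w) *: w.
Proof.
rewrite /sincn /sinc; case: eqVneq => // /eqP.
by rewrite enorm_eq0 => /eqP ->; rewrite !scaler0.
Qed.

Lemma cosn_near0 m : \forall h \near (0 : 'rV[R]_m),
  `|cosn h - 1| <= m%:R / 2 * `|h| ^+ 2 /\ `|sinc (enorm h) - 1| <= m%:R / 2 * `|h| ^+ 2.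
Proof.
have pi2 : 0 < pi / 2 :> R by rewrite divr_gt0// pi_gt0.
have := enorm_near0 m pi2; apply: filterS => h hpi.
have r0 := enorm_ge0 h; rewrite /cosn; have := dotv_le_norm h; rewrite -enorm_sq => hq.
have := @cos_ge_quadratic _ (enorm h); rewrite r0 hpi => /(_ isT) c1.
have c2 := cos_le1 (enorm h); have c3 := sinc_le1 r0.
have c4 : cos (enorm h) <= sinc (enorm h).
  have [->|n0] := eqVneq (enorm h) 0; first by rewrite cos0 sinc0.
  have rpos : 0 < enorm h by rewrite lt_neqAle eq_sym n0.
  rewrite /sinc (negPf n0) ler_pdivlMr// mulrC ltW// sin_gt_rcos// rpos/=.
  by have := @pi_gt0 R; lra.
rewrite !ler0_norm ?subr_le0//; split; lra.
Qed.

Lemma is_diff_cosn0 m : is_diff (0 : 'rV[R]_m) (@cosn m) (\0 : 'rV[R]_m -> R).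
Proof.
apply: (@is_diff_quadratic _ _ _ _ (GRing.null_fun _) _ (m%:R / 2)).
  exact: cst_continuous.
have := cosn_near0 m; apply: filterS => h [h1 _].
by rewrite addr0 subr0 {2}/cosn enorm0 cos0.
Qed.

Lemma is_diff_sincn0 m : is_diff (0 : 'rV[R]_m) (@sincn m) id.
Proof.
apply: (@is_diff_quadratic _ _ _ _ idfun _ (m%:R / 2)); first by move=> z; exact: cvg_id.
have h1 : \forall h \near (0 : 'rV[R]_m), `|h| < 1 by apply: nbhs0_lt.
move: h1 (cosn_near0 m); apply: filterS2 => h h1 [_ h2].
rewrite addr0 !sincnE scaler0 subr0 -[X in _ - idfun X]scale1r /= -scalerBl normrZ.
have := ler_wpM2r (normr_ge0 h) h2 => /le_trans; apply.
by rewrite ler_piMr ?(ltW h1)// mulr_ge0 ?sqr_ge0// divr_ge0.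
Qed.

Lemma differentiable_enorm (V : normedModType R) m (f : V -> 'rV[R]_m) x :
  f x != 0 -> differentiable f x -> differentiable (fun z => enorm (f z)) x.
Proof.
move=> x0 df.
have q0 : 0 < dotv (f x) (f x) by rewrite lt_neqAle dotv_ge0 eq_sym dotv_eq0 x0.
exact: differentiable_comp1 (differentiable_dotv df df) (is_derive1_sqrt q0).
Qed.

Lemma differentiable_cosn m (w : 'rV[R]_m) : differentiable (@cosn m) w.
Proof.
have [->|w0] := eqVneq w 0; first by have [] := is_diff_cosn0 m.
exact: differentiable_comp1 (differentiable_enorm w0 _) (is_derive_cos _).
Qed.

Lemma differentiable_sincn m (w : 'rV[R]_m) : differentiable (@sincn m) w.
Proof.
have [->|w0] := eqVneq w 0; first by have [] := is_diff_sincn0 m.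
have dn : differentiable (@enorm R m) w by exact: (@differentiable_enorm _ _ id).
apply: differentiable_scale => //; apply: differentiableM.
  exact: differentiable_comp1 dn (is_derive_sin _).
by apply: differentiableV => //; rewrite enorm_eq0.
Qed.

Lemma is_derive_line m (w h : 'rV[R]_m) (s : R) : is_derive s 1 (fun t => w + t *: h) h.
Proof.
have D := is_derive_scale (is_derive_id s 1) (is_derive_cst h s 1).
by apply: is_derive_eq; rewrite scaler0 addr0 scale1r add0r.
Qed.

Lemma is_derive_enorm m (p : R -> 'rV[R]_m) dp (s : R) : p s != 0 ->
  is_derive s 1 p dp ->
  is_derive s 1 (fun t => enorm (p t)) (dotv (p s) dp / enorm (p s)).
Proof.
move=> p0 dps.
have q0 : 0 < dotv (p s) (p s) by rewrite lt_neqAle dotv_ge0 eq_sym dotv_eq0 p0.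
have D := is_derive1_comp (is_derive1_sqrt q0) (is_derive_dotv dps dps).
apply: (is_derive_eq D); rewrite (dotvC dp) -/(enorm _).
by field; rewrite enorm_eq0.
Qed.

(** Away from 0 the value is computed along the line w + t h; at 0 both sides
    vanish. *)
Lemma diff_cosn m (w h : 'rV[R]_m) :
  'd (@cosn m) w h = - sinc (enorm w) * dotv w h.
Proof.
have [->|w0] := eqVneq w 0.
  by have [_ ->] := is_diff_cosn0 m; rewrite dot0v mulr0.
have n0 : enorm w != 0 by rewrite enorm_eq0.
have D := is_derive_line w h 0.
have wE : w + 0 *: h = w by rewrite scale0r addr0.
have := @is_derive_diff_comp _ _ _ _ (@cosn m) _ _ _ D; rewrite wE.
move=> /(_ (differentiable_cosn w)) [_ <-].
have Dn : is_derive (0 : R) 1 (fun t => enorm (w + t *: h)) (dotv w h / enorm w).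
  by have := is_derive_enorm _ D; rewrite wE; exact.
have [_] := @is_derive1_comp _ cos (fun t => enorm (w + t *: h)) 0 _ _ (is_derive_cos _) Dn.
by rewrite wE => ->; rewrite /sinc (negPf n0); field.
Qed.

Lemma diff_sincn m (w h : 'rV[R]_m) :
  'd (@sincn m) w h = sinc (enorm w) *: h
    + ((cos (enorm w) - sinc (enorm w)) / enorm w ^+ 2 * dotv w h) *: w.
Proof.
have [->|w0] := eqVneq w 0.
  have [_ ->] := is_diff_sincn0 m.
  by rewrite enorm0 sinc0 scaler0 addr0 scale1r.
have n0 : enorm w != 0 by rewrite enorm_eq0.
have D := is_derive_line w h 0.
have wE : w + 0 *: h = w by rewrite scale0r addr0.
have := @is_derive_diff_comp _ _ _ _ (@sincn m) _ _ _ D; rewrite wE.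
move=> /(_ (differentiable_sincn w)) [_ <-].
have Dn : is_derive (0 : R) 1 (fun t => enorm (w + t *: h)) (dotv w h / enorm w).
  by have := is_derive_enorm _ D; rewrite wE; exact.
have Ds := @is_derive1_comp _ sin (fun t => enorm (w + t *: h)) 0 _ _ (is_derive_sin _) Dn.
have n0' : enorm (w + 0 *: h) != 0 by rewrite wE.
have Di := @is_deriveV _ (fun t => enorm (w + t *: h)) 0 _ 1 n0' Dn.
have [_] := is_derive_scale (is_deriveM Ds Di) D.
rewrite /= wE => ->; rewrite addrC; congr (_ *: _ + _ *: _).
  by rewrite /sinc (negPf n0) -[LHS]/(sin (enorm (w + 0 *: h)) / enorm (w + 0 *: h)) wE.
by rewrite /GRing.scale/= /sinc (negPf n0); field.
Qed.

End SphereCalculus.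

(** * Gradients on the sphere *)

Section SphereGradient.
Variables (R : realType) (n : nat).
Notation E := 'rV[R]_n.+1.
Implicit Types x y z : E.

Lemma sphere_dotv x : sphere x -> dotv x x = 1.
Proof. by move=> Sx; rewrite -enorm_sq Sx expr1n. Qed.

Lemma dotv_sphere x : dotv x x = 1 -> sphere x.
Proof. by move=> xx; rewrite /sphere/= /enorm xx sqrtr1. Qed.

Lemma sphere_neq0 x : sphere x -> x != 0.
Proof. by rewrite -enorm_eq0 => ->; rewrite oner_eq0. Qed.

Lemma radialE (V : Type) (f : E -> V) x : sphere x -> radial f x = f x.
Proof. by rewrite /radial => ->; rewrite invr1 scale1r. Qed.

Lemma sphere_normalize z : z != 0 -> sphere ((enorm z)^-1 *: z).
Proof.
move=> z0; rewrite /sphere/= enormZ ger0_norm ?invr_ge0 ?enorm_ge0//.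
by rewrite mulVf// enorm_eq0.
Qed.

Lemma differentiable_normalize x : x != 0 ->
  differentiable (fun z : E => (enorm z)^-1 *: z) x.
Proof.
move=> x0; apply: differentiable_scale => //; apply: differentiableV.
  exact: (@differentiable_enorm _ _ _ id).
by rewrite enorm_eq0.
Qed.

Lemma near_neq0 x : x != 0 -> \forall z \near x, z != 0.
Proof.
move=> x0; have : 0 < `|x| by rewrite normr_gt0.
move=> /(nbhsx_ballx x); apply: filterS => z; rewrite -ball_normE/= => xz.
by apply: contraTneq xz => ->; rewrite subr0 ltxx.
Qed.

Lemma near_normalize (P : set E) x : sphere x ->
  (\forall y \near x, sphere y -> P y) ->
  \forall z \near x, P ((enorm z)^-1 *: z).
Proof.
move=> Sx Px.
have c : (fun z : E => (enorm z)^-1 *: z) z @[z --> x] --> x.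
  have := differentiable_continuous (differentiable_normalize (sphere_neq0 Sx)).
  by rewrite /prop_for /continuous_at Sx invr1 scale1r.
have z0 := near_neq0 (sphere_neq0 Sx).
have := c _ Px; rewrite nbhs_filterE => Px'; near=> z.
have : sphere ((enorm z)^-1 *: z) -> P ((enorm z)^-1 *: z) by near: z.
by apply; apply: sphere_normalize; near: z.
Unshelve. all: by end_near. Qed.

(** The differential on the sphere is that of the radial extension, so the chain
    rule holds for curves that stay on the sphere. All derivatives of functions
    on the sphere are computed below along such curves. *)
Lemma sphere_curve_diff (V : normedModType R) (f : E -> V) (c : R -> E) dc (s : R) :
  (\forall t \near s, sphere (c t)) -> sdifferentiable f (c s) -> is_derive s 1 c dc ->
  is_derive s 1 (f \o c) (sdiff f (c s) dc).
Proof.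
move=> Sc df Dc; apply: (@near_eq_is_derive _ _ _ (radial f \o c)).
  by apply: filterS Sc => t St /=; rewrite radialE.
exact: is_derive_diff_comp.
Qed.

Lemma sphere_curve_tangent (c : R -> E) dc (s : R) :
  (\forall t \near s, sphere (c t)) -> is_derive s 1 c dc -> tangent (c s) dc.
Proof.
move=> Sc Dc; have D := is_derive_dotv Dc Dc.
have [_] : is_derive s 1 (cst (1 : R)) (dotv dc (c s) + dotv (c s) dc).
  by apply: (near_eq_is_derive _ D); apply: filterS Sc => t /sphere_dotv.
rewrite derive_cst (dotvC dc) /tangent/=; lra.
Qed.

Lemma riesz m (L : {linear 'rV[R]_m -> R}) v : L v = dotv (\row_i L (delta_mx 0 i)) v.
Proof.
rewrite {1}(row_sum_delta v) linear_sum dotvE.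
by apply: eq_bigr => i _; rewrite linearZ/= mxE mulrC.
Qed.

Definition is_sgrad (phi : E -> R) x (g : E) :=
  tangent x g /\ forall v, tangent x v -> sdiff phi x v = dotv g v.

Lemma is_sgrad_uniq phi x g g' : is_sgrad phi x g -> is_sgrad phi x g' -> g = g'.
Proof.
move=> [tg hg] [tg' hg'].
have t : tangent x (g - g').
  by move: tg tg'; rewrite /tangent/= dotvBr => -> ->; rewrite subrr.
apply/eqP; rewrite -subr_eq0 -dotv_eq0 dotvBl -hg// -hg'//.
by rewrite subrr.
Qed.

(** The representing vector is the orthogonal projection to the tangent space of
    the one that represents the differential of the radial extension. *)
Lemma sgradP phi x : sphere x -> is_sgrad phi x (sgrad phi x).
Proof.
move=> Sx; rewrite /sgrad; case: xgetP => [g -> //|] /(_ _) no; exfalso.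
pose a := \row_i 'd (radial phi) x (delta_mx 0 i).
apply: (no (a - dotv x a *: x)); split.
  by rewrite /tangent/= dotvBr dotvZr (sphere_dotv Sx) mulr1 subrr.
by move=> v xv; rewrite dotvBl dotvZl xv mulr0 subr0 /sdiff riesz.
Qed.

Lemma sgrad_unique phi x g : sphere x -> is_sgrad phi x g -> sgrad phi x = g.
Proof. by move=> Sx; apply: is_sgrad_uniq; exact: sgradP. Qed.

Lemma sphere_curve_grad (phi : E -> R) (c : R -> E) dc (s : R) :
  (\forall t \near s, sphere (c t)) -> sdifferentiable phi (c s) -> is_derive s 1 c dc ->
  is_derive s 1 (phi \o c) (dotv (sgrad phi (c s)) dc).
Proof.
move=> Sc df Dc; apply: (is_derive_eq (sphere_curve_diff Sc df Dc)).
by have [_ ->] := sgradP phi (nbhs_singleton Sc) => //; exact: sphere_curve_tangent.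
Qed.

Lemma phi_interp_diff (phi0 phi1 : E -> R) t x :
  sdifferentiable phi0 x -> sdifferentiable phi1 x ->
  is_diff x (radial (phi_interp phi0 phi1 t))
    ((1 - t) *: ('d (radial phi0) x : E -> R) + t *: ('d (radial phi1) x : E -> R)).
Proof.
move=> /differentiableP d0 /differentiableP d1.
exact: (is_diffD (is_diffZ (1 - t) d0) (is_diffZ t d1)).
Qed.

Lemma sgrad_interp (phi0 phi1 : E -> R) t x : sphere x ->
  sdifferentiable phi0 x -> sdifferentiable phi1 x ->
  sgrad (phi_interp phi0 phi1 t) x = (1 - t) *: sgrad phi0 x + t *: sgrad phi1 x.
Proof.
move=> Sx d0 d1; apply: sgrad_unique => //.
move: (sgradP phi0 Sx) (sgradP phi1 Sx).
move: (sgrad phi0 x) (sgrad phi1 x) => a0 a1 [t0 g0] [t1 g1]; split.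
  by rewrite /tangent/= dotvDr !dotvZr t0 t1 !mulr0 addr0.
move=> v xv; have [_] := phi_interp_diff t d0 d1; rewrite /sdiff => ->.
by rewrite dotvDl !dotvZl -g0// -g1.
Qed.

(** The gradient of the interpolated function is the interpolated gradient only
    at points of the sphere near x, where both functions are differentiable;
    hence the detour through functions equal near x. *)
Lemma sgrad_interp_diff (phi0 phi1 : E -> R) t x : sphere x ->
  has_hessian phi0 x -> has_hessian phi1 x ->
  is_diff x (radial (sgrad (phi_interp phi0 phi1 t)))
    ((1 - t) *: ('d (radial (sgrad phi0)) x : E -> E)
     + t *: ('d (radial (sgrad phi1)) x : E -> E)).
Proof.
move=> Sx [n0 /differentiableP d0] [n1 /differentiableP d1].
have D := is_diffD (is_diffZ (1 - t) d0) (is_diffZ t d1).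
have [D1 D2] := D; rewrite -D2; apply: near_eq_is_diff => //.
have z0 := near_neq0 (sphere_neq0 Sx).
have h0 := near_normalize Sx n0; have h1 := near_normalize Sx n1.
near=> z; rewrite /radial sgrad_interp//; try by near: z.
by apply: sphere_normalize; near: z.
Unshelve. all: by end_near. Qed.

End SphereGradient.

(** * Symmetry of second derivatives *)

Section Schwarz.
Variable R : realType.

(** The mean value theorem applied to t |-> f (x + s u + t v) - f (x + t v)
    turns the second difference of f into a first difference of the directional
    derivative K, which is controlled by the differential of K at x alone. *)
Lemma second_difference_bound (V : normedModType R) (f K : V -> R) (L : {linear V -> R})
    (x u v : V) (d e s : R) :
  0 < s -> 0 <= e -> s * (`|u| + `|v|) < d ->
  (forall h, `|h| < d -> is_derive (0 : R) 1 (fun t => f ((x + h) + t *: v)) (K (x + h))) ->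
  (forall h, `|h| < d -> `|K (x + h) - K x - L h| <= e * `|h|) ->
  `|f (x + s *: u + s *: v) - f (x + s *: u) - f (x + s *: v) + f x - s ^+ 2 * L u|
    <= 2 * e * (s ^+ 2 * (`|u| + `|v|)).
Proof.
move=> s0 e0 sd fK KL.
have small (a t : R) : 0 <= a <= s -> 0 <= t <= s ->
    `|a *: u + t *: v| <= s * (`|u| + `|v|).
  move=> /andP[a0 a1] /andP[t0 t1].
  apply: le_trans (ler_normD _ _) _; rewrite !normrZ !ger0_norm// mulrDr.
  by apply: lerD; exact: ler_wpM2r.
have Df (a t : R) : 0 <= a <= s -> 0 <= t <= s ->
    is_derive t 1 (fun t => f (x + (a *: u + t *: v))) (K (x + (a *: u + t *: v))).
  move=> ha ht; have := fK _ (le_lt_trans (small _ _ ha ht) sd) => D0.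
  have D1 : is_derive t 1 (fun t' : R => t' - t) 1.
    by apply: is_derive_eq; rewrite subr0.
  have D0' : is_derive (t - t) 1 (fun b => f (x + (a *: u + t *: v) + b *: v))
      (K (x + (a *: u + t *: v))) by rewrite subrr.
  have := @is_derive1_comp _ _ (fun t' : R => t' - t) _ _ _ D0' D1; rewrite mulr1.
  set F := (X in is_derive _ _ X); rewrite (_ : F = fun t => f (x + (a *: u + t *: v)))//.
  apply/funext => t' /=; congr f; rewrite -!addrA; congr (_ + (_ + _)).
  by rewrite -scalerDl addrC subrK.
pose psi (t : R) := f (x + (s *: u + t *: v)) - f (x + (0 *: u + t *: v)).
pose dpsi (t : R) := K (x + (s *: u + t *: v)) - K (x + (0 *: u + t *: v)).
have ss : 0 <= s <= s by rewrite ltW /=.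
have s00 : 0 <= (0 : R) <= s by apply/andP; split; [exact: lexx | exact: ltW].
have Dpsi (t : R) : 0 <= t <= s -> is_derive t 1 psi (dpsi t).
  by move=> ht; exact: is_deriveB (Df _ _ ss ht) (Df _ _ s00 ht).
have [||t] := @MVT _ psi dpsi 0 s s0.
- by move=> t; rewrite in_itv/= => /andP[? ?]; apply: Dpsi; rewrite !ltW.
- apply: derivable_within_continuous => t; rewrite in_itv/= => ht.
  by apply: ex_derive; exact: Dpsi.
rewrite in_itv/= subr0 => /andP[t0 ts].
have ht : 0 <= t <= s by rewrite !ltW.
rewrite /psi /dpsi !(scale0r, addr0, add0r) addrA.
set A := f _ - _; move=> E.
have -> : f (x + s *: u + s *: v) - f (x + s *: u) - f (x + s *: v) + f x
    = A - (f (x + s *: u) - f x) by rewrite /A; lra.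
rewrite E.
have K1 := KL _ (le_lt_trans (small _ _ ss ht) sd).
have K2 := KL _ (le_lt_trans (small _ _ s00 ht) sd).
have n1 := ler_wpM2l e0 (small _ _ ss ht); have n2 := ler_wpM2l e0 (small _ _ s00 ht).
move: K1 K2 n1 n2; rewrite scale0r add0r linearD 2!linearZ/= => K1 K2 n1 n2.
set k1 := K (x + (_ + _)) in K1 *; set k2 := K (x + t *: v) in K2 *.
have -> : (k1 - k2) * s - s ^+ 2 * L u =
    s * ((k1 - K x - (s * L u + t * L v)) - (k2 - K x - t * L v)) by ring.
rewrite normrM gtr0_norm//.
have -> : 2 * e * (s ^+ 2 * (`|u| + `|v|)) =
    s * (e * (s * (`|u| + `|v|)) + e * (s * (`|u| + `|v|))) by ring.
rewrite ler_wpM2l ?(ltW s0)//; apply: le_trans (ler_normB _ _) _.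
by apply: lerD; [exact: le_trans K1 n1 | exact: le_trans K2 n2].
Qed.

(** Symmetry of the second derivative at a point where it exists, without
    continuity of it: the second difference of f is symmetric in u and v, and
    is s^2 times either mixed derivative up to o(s^2). *)
Lemma schwarz (V : normedModType R) (f Ku Kv : V -> R) (x u v : V) :
  (\forall z \near x, is_derive (0 : R) 1 (fun t => f (z + t *: u)) (Ku z)) ->
  (\forall z \near x, is_derive (0 : R) 1 (fun t => f (z + t *: v)) (Kv z)) ->
  differentiable Ku x -> differentiable Kv x ->
  'd Kv x u = 'd Ku x v.
Proof.
move=> fu fv du dv; set M : R := `|u| + `|v|.
have M0 : 0 <= M by rewrite addr_ge0.
suff H (e : R) : 0 < e -> `|'d Kv x u - 'd Ku x v| <= 4 * e * M.
  apply/eqP; rewrite -subr_eq0 -normr_eq0 eq_le normr_ge0 andbT leNgt; apply/negP => D0.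
  set D := `|_| in H D0.
  have M1 : 0 < 8 * (M + 1) by lra.
  have := H (D / (8 * (M + 1))) (divr_gt0 D0 M1); rewrite leNgt => /negP; apply.
  have -> : 4 * (D / (8 * (M + 1))) * M = D * (M / (2 * (M + 1))) by field; lra.
  by rewrite gtr_pMr// ltr_pdivrMr; lra.
move=> e0.
have near_dist (P : set V) : (\forall z \near x, P z) ->
    exists2 d : R, 0 < d & forall h, `|h| < d -> P (x + h).
  move=> /nbhs_ballP[d d0 Pd]; exists d => // h hd; apply: Pd.
  by rewrite -ball_normE/= opprD addNKr normrN.
have [d1 d10 h1] := near_dist _ fu; have [d2 d20 h2] := near_dist _ fv.
have littleo (K : V -> R) : differentiable K x ->
    exists2 d : R, 0 < d & forall h, `|h| < d -> `|K (x + h) - K x - 'd K x h| <= e * `|h|.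
  move=> dK; have /eqaddoP/(_ e e0)/near0_dist[d d0 hd] := diff_locally dK.
  by exists d => // h /hd; rewrite !fctE/= opprD addrA (addrC h).
have [d3 d30 h3] := littleo _ du; have [d4 d40 h4] := littleo _ dv.
pose d := Num.min (Num.min d1 d2) (Num.min d3 d4).
have d0 : 0 < d by rewrite !lt_min d10 d20 d30 d40.
have lts (r : R) : r < d -> [/\ r < d1, r < d2, r < d3 & r < d4].
  by rewrite !lt_min => /andP[/andP[-> ->] /andP[-> ->]].
(* any positive s with s M < d would do; M may vanish *)
pose s := d / (M + 1); have s0 : 0 < s by rewrite divr_gt0//; lra.
have sd : s * M < d.
  rewrite /s mulrAC ltr_pdivrMr; last lra.
  by rewrite ltr_pM2l//; lra.
have B1 := @second_difference_bound V f Kv ('d Kv x) x u v d e s s0 (ltW e0) sd.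
have sd' : s * (`|v| + `|u|) < d by rewrite addrC.
have B2 := @second_difference_bound V f Ku ('d Ku x) x v u d e s s0 (ltW e0) sd'.
have {}B1 := B1 (fun h hd => h2 h (let: And4 _ p _ _ := lts _ hd in p))
  (fun h hd => h4 h (let: And4 _ _ _ p := lts _ hd in p)).
have {}B2 := B2 (fun h hd => h1 h (let: And4 p _ _ _ := lts _ hd in p))
  (fun h hd => h3 h (let: And4 _ _ p _ := lts _ hd in p)).
rewrite (addrC `|v|) -/M in B2; rewrite -/M in B1.
rewrite (addrAC x (s *: v)) in B2.
set a := 'd Kv x u in B1 *; set b := 'd Ku x v in B2 *.
set p := f (x + s *: u + s *: v) in B1 B2.
set q := f (x + s *: u) in B1 B2; set r := f (x + s *: v) in B1 B2.
have s2 : 0 < s ^+ 2 by rewrite exprn_gt0.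
rewrite -(ler_pM2l s2) -[s ^+ 2 in X in X <= _](ger0_norm (ltW s2)) -normrM.
have -> : s ^+ 2 * (a - b) = (p - r - q + f x - s ^+ 2 * b) - (p - q - r + f x - s ^+ 2 * a).
  by ring.
apply: le_trans (ler_normB _ _) _; move: (lerD B2 B1).
move=> H; apply: (le_trans H); rewrite le_eqVlt; apply/orP; left; apply/eqP; ring.
Qed.

End Schwarz.

(** * The differential of the gradient map *)

Section GradientMap.
Variables (R : realType) (n : nat).
Notation E := 'rV[R]_n.+1.
Implicit Types x y z v w : E.

Lemma near_line_neq0 z v : z != 0 -> \forall t \near (0 : R), z + t *: v != 0.
Proof.
move=> z0; have [+ _] := is_derive_line z v 0.
move=> /derivable1_diffP/differentiable_continuous.
rewrite /prop_for /continuous_at scale0r addr0 => /(_ _ (near_neq0 z0)).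
by rewrite nbhs_filterE.
Qed.

(** The radial projection to the sphere of a line, the curve used to compute
    derivatives in a tangent direction that need not be a unit vector. *)
Lemma is_derive_normalize z v : z != 0 ->
  is_derive (0 : R) 1 (fun t => (enorm (z + t *: v))^-1 *: (z + t *: v))
    ((enorm z)^-1 *: v - (dotv z v / enorm z ^+ 3) *: z).
Proof.
move=> z0; have D := is_derive_line z v 0.
have z0' : z + 0 *: v != 0 by rewrite scale0r addr0.
have Dn := is_derive_enorm z0' D.
have n0 : enorm (z + 0 *: v) != 0 by rewrite enorm_eq0.
have Di := @is_deriveV _ (fun t => enorm (z + t *: v)) 0 _ 1 n0 Dn.
apply: (is_derive_eq (is_derive_scale Di D)).
rewrite scale0r addr0 addrC; congr (_ + _); rewrite -scaleNr; congr (_ *: _).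
by rewrite /GRing.scale/=; field; rewrite enorm_eq0.
Qed.

(** Apply [schwarz] to the radial extension of phi. Its derivative at z in the
    direction w is <grad phi (z/|z|), w> / |z|, and at x the factor 1/|z| does
    not contribute in tangent directions. *)
Lemma hessian_sym (phi : E -> R) x u v : sphere x -> has_hessian phi x ->
  tangent x u -> tangent x v ->
  dotv (sdiff (sgrad phi) x u) v = dotv (sdiff (sgrad phi) x v) u.
Proof.
move=> Sx [nphi dG] xu xv.
pose K w z := dotv (radial (sgrad phi) z) w / enorm z.
have x0 := sphere_neq0 Sx.
have DK w : \forall z \near x,
    is_derive (0 : R) 1 (fun t => radial phi (z + t *: w)) (K w z).
  have z0 := near_neq0 x0; have h := near_normalize Sx nphi.
  near=> z.
  have zn : z != 0 by near: z.
  have hz : sdifferentiable phi ((enorm z)^-1 *: z) by near: z.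
  pose c (t : R) := (enorm (z + t *: w))^-1 *: (z + t *: w).
  have c0 : c 0 = (enorm z)^-1 *: z by rewrite /c scale0r addr0.
  have Sc : \forall t \near (0 : R), sphere (c t).
    by have := near_line_neq0 w zn; apply: filterS => t; exact: sphere_normalize.
  have := @sphere_curve_grad R n phi c _ 0 Sc _ (is_derive_normalize w zn).
  rewrite c0 => /(_ hz) H; apply: (is_derive_eq H).
  have [+ _] := sgradP phi (sphere_normalize zn); rewrite /K /radial.
  move: (sgrad phi _) => g; rewrite /tangent/= dotvZl => /eqP.
  rewrite mulf_eq0 invr_eq0 enorm_eq0 (negPf zn)/= => /eqP zg.
  by rewrite dotvBr !dotvZr (dotvC g z) zg mulr0 subr0 mulrC.
have dn : differentiable (@enorm R n.+1) x by exact: (@differentiable_enorm _ _ _ id).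
have nx0 : enorm x != 0 by rewrite enorm_eq0.
have dK w : differentiable (K w) x.
  apply: differentiableM; first exact: differentiable_dotv dG _.
  exact: differentiableV.
have dKE w h : tangent x h -> 'd (K w) x h = dotv (sdiff (sgrad phi) x h) w.
  move=> xh; have D := is_derive_line x h 0.
  have xE : x + 0 *: h = x by rewrite scale0r addr0.
  have := @is_derive_diff_comp _ _ _ _ (K w) _ _ _ D; rewrite xE.
  move=> /(_ (dK w)) [_ <-].
  have := @is_derive_diff_comp _ _ _ _ (radial (sgrad phi)) _ _ _ D; rewrite xE.
  move=> /(_ dG) DG.
  have Dd := is_derive_dotv DG (is_derive_cst w (0 : R) 1).
  have Dn : is_derive (0 : R) 1 (fun t => enorm (x + t *: h)) 0.
    have := is_derive_enorm _ D; rewrite xE => /(_ x0).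
    by rewrite xh mul0r.
  have nx0' : enorm (x + 0 *: h) != 0 by rewrite xE.
  have Di := @is_deriveV _ (fun t => enorm (x + t *: h)) 0 _ 1 nx0' Dn.
  have [_ ->] := is_deriveM Dd Di.
  rewrite xE Sx /GRing.scale/= /sdiff dotv0 addr0 !(mulr0, mul0r) add0r.
  by rewrite invr1 mul1r.
rewrite -(dKE v u xu) -(dKE u v xv).
exact: (schwarz (DK u) (DK v) (dK u) (dK v)).
Unshelve. all: by end_near. Qed.

Lemma radial_gradmapE (phi : E -> R) : radial (gradmap phi) =
  (fun z => cosn (radial (sgrad phi) z) *: ((enorm z)^-1 *: z) + sincn (radial (sgrad phi) z)).
Proof. by []. Qed.

Lemma differentiable_gradmap (phi : E -> R) x : sphere x ->
  sdifferentiable (sgrad phi) x -> sdifferentiable (gradmap phi) x.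
Proof.
move=> Sx dG; rewrite /sdifferentiable radial_gradmapE.
apply: (@differentiableD _ _ _ (fun z => _ *: _) (fun z => sincn _)).
  apply: differentiable_scale; last exact/differentiable_normalize/sphere_neq0.
  exact: (differentiable_comp dG (differentiable_cosn _)).
exact: (differentiable_comp dG (differentiable_sincn _)).
Qed.

Lemma is_derive_normalize_sphere x w : sphere x -> tangent x w ->
  is_derive (0 : R) 1 (fun t => (enorm (x + t *: w))^-1 *: (x + t *: w)) w.
Proof.
move=> Sx xw; apply: (is_derive_eq (is_derive_normalize w (sphere_neq0 Sx))).
by rewrite Sx xw mul0r scale0r subr0 invr1 scale1r.
Qed.

Lemma sphere_line_near x w : sphere x ->
  \forall t \near (0 : R), sphere ((enorm (x + t *: w))^-1 *: (x + t *: w)).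
Proof.
move=> Sx; have := near_line_neq0 w (sphere_neq0 Sx).
by apply: filterS => t; exact: sphere_normalize.
Qed.

(** The product rule for cosn (grad phi) z + sincn (grad phi) along a curve on the
    sphere through x with velocity w. *)
Lemma sdiff_gradmap (phi : E -> R) x w : sphere x ->
  sdifferentiable (sgrad phi) x -> tangent x w ->
  let v := sgrad phi x in let h := sdiff (sgrad phi) x w in
  sdiff (gradmap phi) x w =
    (- sinc (enorm v) * dotv v h) *: x + cos (enorm v) *: w + sinc (enorm v) *: h
    + ((cos (enorm v) - sinc (enorm v)) / enorm v ^+ 2 * dotv v h) *: v.
Proof.
move=> Sx dG xw v h.
pose c (t : R) := (enorm (x + t *: w))^-1 *: (x + t *: w).
have Dc : is_derive (0 : R) 1 c w by exact: is_derive_normalize_sphere.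
have Sc := sphere_line_near w Sx.
have c0 : c 0 = x by rewrite /c scale0r addr0 Sx invr1 scale1r.
have := @sphere_curve_diff R n _ (gradmap phi) c w 0 Sc; rewrite c0.
move=> /(_ (differentiable_gradmap Sx dG) Dc) [_ <-].
have := @sphere_curve_diff R n _ (sgrad phi) c w 0 Sc; rewrite c0.
move=> /(_ dG Dc) DG.
have G0 : (sgrad phi \o c) 0 = v by rewrite /= c0.
have D1 := @is_derive_diff_comp _ _ _ _ (@cosn R n.+1) _ _ (differentiable_cosn _) DG.
have D2 := @is_derive_diff_comp _ _ _ _ (@sincn R n.+1) _ _ (differentiable_sincn _) DG.
have H : is_derive (0 : R) 1 (gradmap phi \o c) _ := is_deriveD (is_derive_scale D1 Dc) D2.
have [_ ->] := H.
by rewrite diff_cosn diff_sincn /= c0 -/v -/h /cosn !addrA.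
Qed.

(** Differentiate the identity <z, grad phi (z)> = 0. *)
Lemma dotv_sdiff_sgrad (phi : E -> R) x w : sphere x ->
  sdifferentiable (sgrad phi) x -> tangent x w ->
  dotv x (sdiff (sgrad phi) x w) = - dotv (sgrad phi x) w.
Proof.
move=> Sx dG xw.
pose c (t : R) := (enorm (x + t *: w))^-1 *: (x + t *: w).
have Dc : is_derive (0 : R) 1 c w by exact: is_derive_normalize_sphere.
have Sc := sphere_line_near w Sx.
have c0 : c 0 = x by rewrite /c scale0r addr0 Sx invr1 scale1r.
have := @sphere_curve_diff R n _ (sgrad phi) c w 0 Sc; rewrite c0.
move=> /(_ dG Dc) DG.
have [_] : is_derive (0 : R) 1 (cst (0 : R))
    (dotv w ((sgrad phi \o c) 0) + dotv (c 0) (sdiff (sgrad phi) x w)).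
  apply: (near_eq_is_derive _ (is_derive_dotv Dc DG)).
  by apply: filterS Sc => t /(sgradP phi)[+ _] /=.
rewrite derive_cst /= c0 => /esym/eqP; rewrite addrC addr_eq0 => /eqP ->.
by rewrite (dotvC w).
Qed.

End GradientMap.

(** * The Jacobian of the gradient map *)

Section Jacobian.
Variables (R : realType).

Lemma mulmx_dyad m (w a b : 'rV[R]_m) : w *m (a^T *m b) = dotv w a *: b.
Proof. by rewrite mulmxA tr_rowvec mul_scalar_mx. Qed.

(** The orthogonal projection to the tangent space at x. *)
Definition tproj m (x : 'rV[R]_m) : 'M[R]_m := 1%:M - x^T *m x.

Lemma mulmx_tproj m (x w : 'rV[R]_m) : w *m tproj x = w - dotv x w *: x.
Proof. by rewrite mulmxBr mulmx1 mulmx_dyad dotvC. Qed.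

Lemma tproj_tr m (x : 'rV[R]_m) : (tproj x)^T = tproj x.
Proof. by rewrite linearB/= trmx1 trmx_mul trmxK. Qed.

(** The form Hess phi + Hess c(., exp_x v) on the tangent space at x, completed
    by the identity on the line of x, when D is the differential of the gradient
    field. *)
Definition jac_form m (x v : 'rV[R]_m) (D : 'M[R]_m) : 'M[R]_m :=
  x^T *m x + tproj x *m D *m tproj x + rcot (enorm v) *: tproj x
  + ((1 - rcot (enorm v)) / enorm v ^+ 2) *: (v^T *m v).

Lemma sinc_rcot (r : R) : sin r != 0 \/ r = 0 -> sinc r * rcot r = cos r.
Proof.
have [->|r0] := eqVneq r 0; first by rewrite sinc0 rcot0 cos0 mulr1.
case=> [s0|/eqP]; last by rewrite (negPf r0).
by rewrite /sinc /rcot (negPf r0); field; rewrite s0.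
Qed.

Lemma cos2_sinc2 (r : R) : cos r ^+ 2 + sinc r ^+ 2 * r ^+ 2 = 1.
Proof. by rewrite -exprMn sincE cos2Dsin2. Qed.

(** The differential of exp_x at v on the tangent space, completed by
    x |-> exp_x v. *)
Definition exp_jac m (x v : 'rV[R]_m) : 'M[R]_m :=
  let s := sinc (enorm v) in let c := cos (enorm v) in
  s%:M + (x^T *m ((c - s) *: x + s *: v) +
          v^T *m (((c - s) / enorm v ^+ 2) *: v - s *: x)).

Lemma div_sq_mul (a r : R) : (r = 0 -> a = 0) -> a / r ^+ 2 * r ^+ 2 = a.
Proof.
move=> ar; have [r0|r0] := eqVneq r 0; first by rewrite r0 ar ?mul0r.
by rewrite divfK// expf_neq0.
Qed.

Lemma det_exp_jac n (x v : 'rV[R]_n.+2) : sphere x -> tangent x v ->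
  0 < sinc (enorm v) -> \det (exp_jac x v) = sinc (enorm v) ^+ n.
Proof.
move=> Sx xv s0; apply: det_rank2_update.
- exact: lt0r_neq0.
- exact: sphere_dotv.
- exact: xv.
- by rewrite -enorm_sq cos2_sinc2.
- by rewrite -enorm_sq div_sq_mul// => ->; rewrite cos0 sinc0 subrr.
Qed.

Lemma jac_form_row_x m (x v : 'rV[R]_m) D : dotv x x = 1 -> dotv x v = 0 ->
  x *m jac_form x v D = x.
Proof.
move=> xx xv; rewrite /jac_form 3!mulmxDr -!scalemxAr !mulmx_dyad !mulmxA.
by rewrite (mulmx_tproj x x) xx xv scale1r subrr !mul0mx !(scale0r, scaler0) !addr0.
Qed.

Lemma jac_form_row_tangent m (x v w : 'rV[R]_m) D : dotv x w = 0 ->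
  w *m jac_form x v D = (w *m D - dotv x (w *m D) *: x) + rcot (enorm v) *: w
    + ((1 - rcot (enorm v)) / enorm v ^+ 2 * dotv v w) *: v.
Proof.
move=> xw; rewrite /jac_form 3!mulmxDr -!scalemxAr !mulmx_dyad !mulmxA.
rewrite (mulmx_tproj x w) xw scale0r subr0 mulmx_tproj (dotvC w x) xw (dotvC w v).
by rewrite scale0r add0r scalerA.
Qed.

Lemma exp_jac_row m (x v w : 'rV[R]_m) :
  w *m exp_jac x v = sinc (enorm v) *: w
   + dotv w x *: ((cos (enorm v) - sinc (enorm v)) *: x + sinc (enorm v) *: v)
   + dotv w v *: (((cos (enorm v) - sinc (enorm v)) / enorm v ^+ 2) *: v
                   - sinc (enorm v) *: x).
Proof. by rewrite /exp_jac mulmxDr mul_mx_scalar mulmxDr !mulmx_dyad addrA. Qed.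

(** The right-hand side is the differential of the gradient map given by
    [sdiff_gradmap]; the identity is the factorization of this differential
    through the exponential map. *)
Lemma jac_form_exp_jac m (x v w : 'rV[R]_m) D :
  dotv x x = 1 -> dotv x v = 0 -> dotv x w = 0 ->
  sin (enorm v) != 0 \/ enorm v = 0 ->
  dotv x (w *m D) = - dotv v w ->
  w *m (jac_form x v D *m exp_jac x v) =
    (- sinc (enorm v) * dotv v (w *m D)) *: x + cos (enorm v) *: w
    + sinc (enorm v) *: (w *m D)
    + ((cos (enorm v) - sinc (enorm v)) / enorm v ^+ 2 * dotv v (w *m D)) *: v.
Proof.
move=> xx xv xw hr xh; rewrite mulmxA jac_form_row_tangent// exp_jac_row xh.
move: (w *m D) xh => h xh; have vv := enorm_sq v; have sc := sinc_rcot hr.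
have rr := @div_sq_mul (1 - rcot (enorm v)) (enorm v).
have {rr} rr : (1 - rcot (enorm v)) / enorm v ^+ 2 * enorm v ^+ 2 = 1 - rcot (enorm v).
  by apply: rr => ->; rewrite rcot0 subrr.
have kE : (cos (enorm v) - sinc (enorm v)) / enorm v ^+ 2 =
    - sinc (enorm v) * ((1 - rcot (enorm v)) / enorm v ^+ 2).
  by rewrite -sc; ring.
rewrite kE; move: (_ / _) rr kE => k rr kE.
rewrite !(dotvDl, dotvZl, dotvNl) -vv xx (dotvC h x) (dotvC w x) (dotvC v x) xh xw xv.
rewrite (dotvC h v) (dotvC w v) -sc; move: (sinc _) (rcot _) rr (dotv v h) (dotv v w) => s c rr p q.
have -> : k * q * enorm v ^+ 2 = (1 - c) * q by rewrite mulrAC rr.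
by apply/rowP => j; rewrite !mxE; ring.
Qed.

Definition hess_mx n (phi : 'rV[R]_n.+1 -> R) (x : 'rV[R]_n.+1) : 'M[R]_n.+1 :=
  lin1_mx (sdiff (sgrad phi) x).

Lemma mul_hess_mx n (phi : 'rV[R]_n.+1 -> R) x w : w *m hess_mx phi x = sdiff (sgrad phi) x w.
Proof. exact: mul_rV_lin1. Qed.

Lemma sphere_sexp n (x v : 'rV[R]_n.+1) : sphere x -> tangent x v -> sphere (sexp x v).
Proof.
move=> Sx xv; apply: dotv_sphere; rewrite /sexp -/(sincn v) sincnE.
rewrite !(dotvDl, dotvDr, dotvZl, dotvZr) (sphere_dotv Sx) (dotvC v x) xv -enorm_sq.
by rewrite -[RHS](cos2_sinc2 (enorm v)); ring.
Qed.

(** The determinant of a product: the completed form fixes x and the completed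
    differential of exp_x sends it to the image point. *)
Theorem sjac_gradmap n (phi : 'rV[R]_n.+2 -> R) x : sphere x ->
  sdifferentiable (sgrad phi) x -> enorm (sgrad phi x) < pi ->
  sjac (gradmap phi) x =
    sinc (enorm (sgrad phi x)) ^+ n * \det (jac_form x (sgrad phi x) (hess_mx phi x)).
Proof.
move=> Sx dG vpi; have [xv _] := sgradP phi Sx.
have Sy := sphere_sexp Sx xv.
have r0 := enorm_ge0 (sgrad phi x).
have s0 : 0 < sinc (enorm (sgrad phi x)) by rewrite sinc_gt0// r0.
have hr : sin (enorm (sgrad phi x)) != 0 \/ enorm (sgrad phi x) = 0.
  have [->|rn] := eqVneq (enorm (sgrad phi x)) 0; [by right|left].
  by rewrite gt_eqF// sin_gt0_pi// vpi andbT lt_neqAle eq_sym rn.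
have xx := sphere_dotv Sx.
rewrite (@sjacE _ _ _ _ (jac_form x (sgrad phi x) (hess_mx phi x) *m exp_jac x (sgrad phi x)))//.
- by rewrite det_mulmx det_exp_jac// mulrC.
- rewrite mulmxA jac_form_row_x// exp_jac_row xx xv scale0r addr0 scale1r.
  rewrite /gradmap /sexp -/(sincn _) sincnE addrA -scalerDl addrC.
  by rewrite addrC (addrC (sinc _)) subrK.
move=> w xw; rewrite sdiff_gradmap// -!mul_hess_mx jac_form_exp_jac//.
by rewrite mul_hess_mx dotv_sdiff_sgrad.
Qed.

Lemma jac_form_sym m (x v : 'rV[R]_m) D :
  (forall u w, dotv x u = 0 -> dotv x w = 0 -> dotv (u *m D) w = dotv (w *m D) u) ->
  dotv x x = 1 -> (jac_form x v D)^T = jac_form x v D.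
Proof.
move=> symD xx.
have P0 u : dotv x (u *m tproj x) = 0.
  by rewrite mulmx_tproj dotvBr dotvZr xx mulr1 subrr.
have PDP : (tproj x *m D *m tproj x)^T = tproj x *m D *m tproj x.
  apply/matrixP => i j; rewrite mxE.
  have e (A : 'M[R]_m) (k l : 'I_m) : A k l = dotv (delta_mx 0 k *m A) (delta_mx 0 l).
    by rewrite dotv_delta -rowE mxE.
  rewrite !e !mulmxA !(dotv_mulmx (tproj x)) !tproj_tr.
  by rewrite symD.
have trD (A B : 'M[R]_m) : (A + B)^T = A^T + B^T by rewrite linearD.
have trZ a (A : 'M[R]_m) : (a *: A)^T = a *: A^T by rewrite linearZ.
by rewrite /jac_form !trD PDP !trZ !trmx_mul !trmxK tproj_tr.
Qed.

Lemma qform_jac_form m (x v : 'rV[R]_m) D u :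
  dotv x x = 1 -> dotv x v = 0 ->
  qform (jac_form x v D) u = dotv x u ^+ 2
    + (dotv (u *m tproj x *m D) (u *m tproj x) + hess_cost v (u *m tproj x)).
Proof.
move=> xx xv; have PP : dotv (u *m tproj x) u = dotv (u *m tproj x) (u *m tproj x).
  have xw : dotv x (u *m tproj x) = 0.
    by rewrite mulmx_tproj dotvBr dotvZr xx mulr1 subrr.
  by rewrite [in X in _ = dotv _ X]mulmx_tproj dotvBr dotvZr (dotvC _ x) xw mulr0 subr0.
have vP : dotv v (u *m tproj x) = dotv v u.
  by rewrite mulmx_tproj dotvBr dotvZr (dotvC v x) xv mulr0 subr0.
rewrite /qform /jac_form 3!mulmxDr -!scalemxAr !mulmx_dyad !mulmxA.
rewrite !dotvDl !dotvZl PP (dotv_mulmx (tproj x)) tproj_tr.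
by rewrite /hess_cost vP (dotvC u x) (dotvC u v); ring.
Qed.

End Jacobian.

(** * Existence of c-subgradients *)

Section Subdifferential.
Variables (R : realType) (n : nat).
Notation E := 'rV[R]_n.+1.
Implicit Types x y z : E.

Lemma dotv_sphere_itv x y : sphere x -> sphere y -> -1 <= dotv x y <= 1.
Proof.
move=> Sx Sy; have := dotv_cauchy x y; rewrite !sphere_dotv// mulr1 => h.
by rewrite -ler_norml -(ler_pXn2r (n := 2))// ?nnegrE// real_normK ?num_real// expr1n.
Qed.

(** Continuity of acos up to the end points, where it is not differentiable, by
    monotonicity of cos. *)
Lemma acos_continuous_itv (m0 e : R) : -1 <= m0 <= 1 -> 0 < e ->
  exists2 d, 0 < d & forall m, -1 <= m <= 1 -> `|m - m0| < d -> `|acos m - acos m0| < e.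
Proof.
move=> h0 e0; have [a0 a1] : 0 <= acos m0 /\ acos m0 <= pi.
  by split; [exact: acos_ge0 | exact: acos_lepi].
have m0E : cos (acos m0) = m0 by rewrite acosK// in_itv.
have up : exists2 d, 0 < d & forall m, -1 <= m <= 1 -> m0 - m < d -> acos m < acos m0 + e.
  have [le|lt] := leP (acos m0 + e) pi; last first.
    exists 1 => // m hm _; exact: le_lt_trans (acos_lepi hm) lt.
  exists (m0 - cos (acos m0 + e)).
    rewrite subr_gt0 -{2}m0E ltr_cos ?in_itv/=; [lra|lra|lra].
  move=> m hm; rewrite ltrD2l ltrN2 -{1}(@acosK _ m) ?in_itv//=.
  rewrite ltr_cos ?in_itv/= ?acos_ge0 ?acos_lepi//; lra.
have down : exists2 d, 0 < d & forall m, -1 <= m <= 1 -> m - m0 < d -> acos m0 - e < acos m.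
  have [le|lt] := leP 0 (acos m0 - e); last first.
    exists 1 => // m hm _; exact: lt_le_trans lt (acos_ge0 hm).
  exists (cos (acos m0 - e) - m0).
    rewrite subr_gt0 -{1}m0E ltr_cos ?in_itv/=; [lra|lra|lra].
  move=> m hm; rewrite ltrD2r -{1}(@acosK _ m) ?in_itv//=.
  rewrite ltr_cos ?in_itv/= ?acos_ge0 ?acos_lepi//; lra.
have [d1 d10 h1] := up; have [d2 d20 h2] := down.
exists (Num.min d1 d2); first by rewrite lt_min d10.
move=> m hm; rewrite lt_min => /andP[n1 n2].
have : m0 - m < d1 by apply: le_lt_trans n1; rewrite distrC ler_norm.
have : m - m0 < d2 by apply: le_lt_trans n2; exact: ler_norm.
move=> /(h2 _ hm) l /(h1 _ hm) u; rewrite ltr_norml; apply/andP; split; lra.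
Qed.

(** The cost is continuous also at antipodal pairs, where it is not differentiable. *)
Lemma cost_continuous z y (e : R) : sphere z -> sphere y -> 0 < e ->
  \forall y' \near y, sphere y' -> `|cost z y' - cost z y| < e.
Proof.
move=> Sz Sy e0; have p0 := @pi_gt0 R.
have [d d0 hd] := acos_continuous_itv (dotv_sphere_itv Sz Sy) (divr_gt0 e0 p0).
have c : {for y, continuous (fun y' => dotv z y')}.
  by apply: differentiable_continuous; exact: (@differentiable_dotv _ _ _ (cst z) id).
have H : \forall y' \near y, `|dotv z y' - dotv z y| < d by exact: cvgr_distC_lt c _ d0.
apply: filterS H => y' yd Sy'.
have h' := dotv_sphere_itv Sz Sy'; have h := dotv_sphere_itv Sz Sy.
have := hd _ h' yd; rewrite /cost /geodist ltr_pdivlMr//.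
have := acos_ge0 h; have := acos_lepi h; have := acos_ge0 h'; have := acos_lepi h'.
move: (acos _) (acos _) => a' a a'1 a'0 a1 a0 /= ad.
rewrite -mulrBr subr_sqr !normrM gtr0_norm ?invr_gt0//.
apply: le_lt_trans ad; rewrite mulrCA ler_wpM2l// ger0_norm ?addr_ge0//; lra.
Qed.

Lemma sphere_compact : compact (@sphere R n).
Proof.
apply: bounded_closed_compact.
  exists 1; split; first exact: num_real.
  move=> M M1 x Sx /=; apply: le_trans (ltW M1).
  rewrite [leLHS]/Num.Def.normr/= mx_normrE.
  apply: bigmax_le => // -[i j] _ /=; rewrite ord1.
  rewrite -(ler_pXn2r (n := 2))// ?nnegrE// real_normK ?num_real// expr1n.
  rewrite -(sphere_dotv Sx) dotvE (bigD1 j)//= -expr2 lerDl.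
  by apply: sumr_ge0 => k _; rewrite -expr2 sqr_ge0.
have -> : sphere = (fun x : E => dotv x x) @^-1` [set 1].
  by apply/seteqP; split => x /=; [exact: sphere_dotv | exact: dotv_sphere].
apply: closed_comp; last exact: closed_eq.
move=> x _; apply: differentiable_continuous.
exact: (@differentiable_dotv _ _ _ id id).
Qed.

(** A point almost realizing the supremum in the double transform. The inner
    transform is finite at such a point. *)
Lemma ctransform_approx (phi : E -> R) x (e : R) : c_convex phi -> sphere x -> 0 < e ->
  exists2 y, sphere y & forall z, sphere z -> phi x + cost x y <= phi z + cost z y + e.
Proof.
move=> cphi Sx e0; pose psi := ctransform (fun z => (phi z)%:E).
have psix : ctransform psi x = (phi x)%:E := cphi x Sx.
have lt : ((phi x - e)%:E < ctransform psi x)%E by rewrite psix lte_fin ltrBlDr ltrDl.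
have [_ [y Sy <-] ylt] := ereal_sup_gt lt.
exists y => // z Sz.
have psiy : ((- cost z y)%:E - (phi z)%:E <= psi y)%E.
  by apply: ereal_sup_ubound; exists z.
have cyx : cost y x = cost x y by rewrite /cost /geodist dotvC.
move: ylt psiy; rewrite cyx; case: (psi y) => [r| |]//=.
rewrite -!EFinB lte_fin lee_fin; lra.
Qed.

(** The supremum in the double transform is attained: take a cluster point of
    approximate maximizers, by compactness of the sphere and continuity of the
    cost for fixed x and z. *)
Theorem c_subdifferential (phi : E -> R) x : c_convex phi -> sphere x ->
  exists2 y, sphere y & forall z, sphere z -> phi x + cost x y <= phi z + cost z y.
Proof.
move=> cphi Sx.
have : forall k : nat, exists y, sphere y /\ forall z, sphere z ->
    phi x + cost x y <= phi z + cost z y + k.+1%:R^-1.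
  move=> k; have [|y Sy hy] := @ctransform_approx phi x k.+1%:R^-1 cphi Sx.
    by rewrite invr_gt0.
  by exists y.
move=> /choice[y_ hy].
have [|y [Sy cy]] := @sphere_compact (y_ @ \oo) (fmap_proper_filter _ _).
  suff : \forall k \near \oo, sphere (y_ k) by [].
  by near=> k; have [] := hy k.
exists y => // z Sz; rewrite leNgt; apply/negP => lt.
(* one e for the approximation and one for each of the two costs *)
pose e := (phi x + cost x y - (phi z + cost z y)) / 3.
have e0 : 0 < e by rewrite divr_gt0// subr_gt0.
pose P (y' : E) := sphere y' /\ phi x + cost x y' <= phi z + cost z y' + e.
have A : \forall k \near \oo, P (y_ k).
  near=> k; have [Sk hk] := hy k; split => //.
  apply: le_trans (hk z Sz) _; rewrite lerD2l.
  by apply: ltW; near: k; exact: (near_infty_natSinv_lt (PosNum e0)).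
pose Q w (y' : E) := sphere y' -> `|cost w y' - cost w y| < e.
have B : nbhs y (Q z `&` Q x).
  by apply: filterI; [exact: cost_continuous | exact: cost_continuous].
have [y' [[Sy' h] [/(_ Sy') hz /(_ Sy') hx]]] := cy P (Q z `&` Q x) A B.
have eE : 3 * e = phi x + cost x y - (phi z + cost z y).
  by rewrite /e mulrC divfK.
move: hz hx; rewrite !ltr_norml => /andP[hz1 hz2] /andP[hx1 hx2]; lra.
Unshelve. all: by end_near. Qed.
End Subdifferential.

(** * First and second order conditions at a c-subgradient *)

Section OneVarMin.
Variable R : realType.

Lemma is_derive_littleo (k : R -> R) (d e : R) : is_derive (0 : R) 1 k d -> 0 < e ->
  exists2 r : R, 0 < r & forall h, `|h| < r -> `|k h - k 0 - d * h| <= e * `|h|.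
Proof.
move=> [/derivable1_diffP dk kE] e0.
have /eqaddoP/(_ e e0)/nbhs_ballP[r r0 hr] := diff_locally dk.
exists r => // h hh; have := hr h; rewrite -ball_normE/= sub0r normrN => /(_ hh).
rewrite !fctE/= addr0 opprD addrA.
suff -> : 'd k 0 h = d * h by [].
by rewrite -[h in LHS]mulr1 -[h * 1]/(h *: 1) linearZ/= -deriveE// kE /GRing.scale/= mulrC.
Qed.

(** One-sided, because along a geodesic through x the cost to -x has a corner and
    is smooth on each side only. *)
Lemma right_min_derive_ge0 (k : R -> R) (d : R) : is_derive (0 : R) 1 k d ->
  (\forall s \near (0 : R), 0 <= s -> k 0 <= k s) -> 0 <= d.
Proof.
move=> Dk /near0_dist[r1 r10 h1]; rewrite leNgt; apply/negP => d0.
have [|r2 r20 h2] := is_derive_littleo Dk (_ : 0 < - d / 2); first lra.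
pose h := Num.min r1 r2 / 2.
have m0 : 0 < Num.min r1 r2 by rewrite lt_min r10.
have h0 : 0 < h by rewrite divr_gt0.
have hm : `|h| < Num.min r1 r2 by rewrite gtr0_norm// /h; lra.
move: hm; rewrite lt_min => /andP[/h1 hr1 /h2].
rewrite (gtr0_norm h0) => /ler_normlW.
have := hr1 (ltW h0); nra.
Qed.

(** The classical second-order condition, assuming that the first derivative
    exists near 0 and is differentiable at 0 only. *)
Lemma second_order_min (k dk : R -> R) (L : R) :
  (\forall s \near (0 : R), is_derive (s : R) 1 k (dk s)) ->
  is_derive (0 : R) 1 dk L -> dk 0 = 0 ->
  (\forall s \near (0 : R), k 0 <= k s) -> 0 <= L.
Proof.
move=> /near0_dist[r1 r10 h1] Dd dk0 /near0_dist[r3 r30 h3].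
rewrite leNgt; apply/negP => L0.
have [|r2 r20 h2] := is_derive_littleo Dd (_ : 0 < - L / 2); first lra.
pose m := Num.min r1 (Num.min r2 r3).
have m0 : 0 < m by rewrite !lt_min r10 r20.
pose h := m / 2; have h0 : 0 < h by rewrite divr_gt0.
have hm : h < m by rewrite /h; lra.
move: (hm); rewrite !lt_min => /and3P[hr1 hr2 hr3].
have inr (s : R) : 0 <= s -> s <= h -> `|s| < r1.
  by move=> s0 sh; rewrite ger0_norm//; exact: le_lt_trans hr1.
have [||c] := @MVT _ k dk 0 h h0.
- by move=> s; rewrite in_itv/= => /andP[s0 sh]; apply: h1; apply: inr; exact: ltW.
- apply: derivable_within_continuous => s; rewrite in_itv/= => /andP[s0 sh].
  by apply: ex_derive; apply: h1; exact: inr.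
rewrite in_itv/= subr0 => /andP[c0 ch] E.
have := h2 c; rewrite gtr0_norm// (lt_trans ch)// => /(_ isT)/ler_normlW.
rewrite dk0 subr0 => h2c.
have := h3 h; rewrite gtr0_norm// => /(_ hr3) k3.
have : dk c < 0 by nra.
have : 0 <= dk c * h by rewrite -E subr_ge0.
nra.
Qed.

End OneVarMin.

Section Geodesics.
Variables (R : realType) (n : nat).
Notation E := 'rV[R]_n.+1.
Implicit Types (x y z xi : E) (s : R).

Definition geodesic x (xi : E) (s : R) : E := cos s *: x + sin s *: xi.

Lemma geodesic0 x xi : geodesic x xi 0 = x.
Proof. by rewrite /geodesic cos0 sin0 scale0r addr0 scale1r. Qed.

Lemma sphere_geodesic x xi s : sphere x -> sphere xi -> tangent x xi ->
  sphere (geodesic x xi s).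
Proof.
move=> Sx Sxi xxi; apply: dotv_sphere.
rewrite !(dotvDl, dotvDr, dotvZl, dotvZr) !sphere_dotv// (dotvC xi x) xxi.
by rewrite -[RHS](cos2Dsin2 s); ring.
Qed.

Lemma is_derive_comb (k1 k2 : R -> R) (d1 d2 : R) (x xi : E) (s : R) :
  is_derive s 1 k1 d1 -> is_derive s 1 k2 d2 ->
  is_derive s 1 (fun t => k1 t *: x + k2 t *: xi) (d1 *: x + d2 *: xi).
Proof.
move=> D1 D2.
have := is_deriveD (is_derive_scale D1 (is_derive_cst x s 1)) (is_derive_scale D2 (is_derive_cst xi s 1)).
by move=> H; apply: (is_derive_eq H); rewrite !scaler0 !addr0.
Qed.

Lemma is_derive_geodesic x xi s :
  is_derive s 1 (geodesic x xi) (- sin s *: x + cos s *: xi).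
Proof. exact: is_derive_comb. Qed.

Lemma near_geodesic (P : set E) x xi : sphere x -> sphere xi -> tangent x xi ->
  (\forall y \near x, sphere y -> P y) ->
  \forall s \near (0 : R), P (geodesic x xi s).
Proof.
move=> Sx Sxi xxi nP.
have c : {for (0 : R), continuous (geodesic x xi)}.
  have [+ _] := is_derive_geodesic x xi 0.
  by move=> /derivable1_diffP/differentiable_continuous.
have : \forall s \near (0 : R), sphere (geodesic x xi s) -> P (geodesic x xi s).
  by move: c; rewrite /prop_for /continuous_at geodesic0 => /(_ _ nP).
by apply: filterS => s; apply; exact: sphere_geodesic.
Qed.

Definition geo_cos x xi y (s : R) : R := cos s * dotv x y + sin s * dotv xi y.

Lemma cost_geodesic x xi y s :
  cost (geodesic x xi s) y = 2^-1 * acos (geo_cos x xi y s) ^+ 2.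
Proof. by rewrite /cost /geodist /geodesic dotvDl !dotvZl. Qed.

Lemma is_derive_geo_cos x xi y s :
  is_derive s 1 (geo_cos x xi y) (- sin s * dotv x y + cos s * dotv xi y).
Proof.
by rewrite /geo_cos; apply: is_derive_eq; rewrite /GRing.scale/=; ring.
Qed.

(** The derivative of half the square of acos. *)
Definition dcost (m : R) := - (acos m / Num.sqrt (1 - m ^+ 2)).

Lemma is_derive_half_acos2 (m : R) : -1 < m < 1 ->
  is_derive m 1 (fun m => 2^-1 * acos m ^+ 2) (dcost m).
Proof.
move=> hm; have D := is_derive1_acos hm.
by apply: is_derive_eq; rewrite /GRing.scale/= /dcost; field; rewrite ?gt_eqF// sqrtr_gt0; nra.
Qed.

Lemma is_derive_cost_geodesic x xi y s : -1 < geo_cos x xi y s < 1 ->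
  is_derive s 1 (fun s => cost (geodesic x xi s) y)
    (dcost (geo_cos x xi y s) * (- sin s * dotv x y + cos s * dotv xi y)).
Proof.
move=> hm.
have := is_derive1_comp (is_derive_half_acos2 hm) (is_derive_geo_cos x xi y s).
by congr is_derive; apply/funext => t /=; rewrite cost_geodesic.
Qed.

Lemma near_geo_cos x xi y : -1 < dotv x y < 1 ->
  \forall s \near (0 : R), -1 < geo_cos x xi y s < 1.
Proof.
move=> /andP[h1 h2].
have c : geo_cos x xi y s @[s --> (0 : R)] --> dotv x y.
  have [+ _] := is_derive_geo_cos x xi y 0.
  move=> /derivable1_diffP/differentiable_continuous.
  by rewrite /prop_for /continuous_at {2}/geo_cos cos0 sin0 mul0r addr0 mul1r.
have H1 : \forall s \near (0 : R), -1 < geo_cos x xi y s by exact: cvgr_gt c _ h1.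
have H2 : \forall s \near (0 : R), geo_cos x xi y s < 1 by exact: cvgr_lt c _ h2.
by apply: filterS2 H1 H2 => s -> ->.
Qed.

Lemma is_derive_dcost (m : R) : -1 < m < 1 ->
  is_derive m 1 dcost
    ((1 - m ^+ 2)^-1 - acos m * m / Num.sqrt (1 - m ^+ 2) ^+ 3).
Proof.
move=> hm; have q0 : 0 < 1 - m ^+ 2 by nra.
have s0 : 0 < Num.sqrt (1 - m ^+ 2) by rewrite sqrtr_gt0.
have D := is_derive1_acos hm.
have Dq : is_derive m 1 (fun t : R => 1 - t ^+ 2) (- (2 * m)).
  by apply: is_derive_eq; rewrite /GRing.scale/=; ring.
have Ds := @is_derive1_comp _ Num.sqrt (fun t : R => 1 - t ^+ 2) m _ _ (is_derive1_sqrt q0) Dq.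
have s0' : (Num.sqrt \o (fun t : R => 1 - t ^+ 2)) m != 0 by rewrite gt_eqF.
have Di := @is_deriveV _ _ m _ 1 s0' Ds.
have H : is_derive m 1 dcost _ := is_deriveN (is_deriveM D Di).
apply: (is_derive_eq H); rewrite /GRing.scale/=.
have -> : (1 - m ^+ 2)^-1 = (Num.sqrt (1 - m ^+ 2) ^+ 2)^-1 by rewrite sqr_sqrtr// ltW.
move: (Num.sqrt _) (acos m) s0 => s a s0.
by field; rewrite gt_eqF.
Qed.

End Geodesics.

Section Optimality.
Variables (R : realType) (n : nat).
Notation E := 'rV[R]_n.+1.
Implicit Types (x y z v w xi : E) (s : R) (phi : E -> R).

Lemma unit_tangent x w : w != 0 -> tangent x w ->
  sphere ((enorm w)^-1 *: w) /\ tangent x ((enorm w)^-1 *: w).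
Proof.
move=> w0 xw; split; first exact: sphere_normalize.
by rewrite /tangent/= dotvZr xw mulr0.
Qed.

Lemma sphereN x : sphere x -> sphere (- x).
Proof. by rewrite /sphere/= /enorm dotvNl dotvNr opprK. Qed.

Lemma tangentN x w : tangent x w -> tangent x (- w).
Proof. by rewrite /tangent/= dotvNr => ->; rewrite oppr0. Qed.

Lemma tangent_eq0 x w : tangent x w ->
  (forall xi, sphere xi -> tangent x xi -> 0 <= dotv w xi) -> w = 0.
Proof.
move=> xw h; apply/eqP/negPn/negP => w0; have [S1 T1] := unit_tangent w0 xw.
have := h _ (sphereN S1) (tangentN T1).
rewrite dotvNr dotvZr -enorm_sq expr2 mulKf ?enorm_eq0// oppr_ge0 leNgt => /negP; apply.
by rewrite lt_neqAle enorm_ge0 eq_sym enorm_eq0 w0.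
Qed.

Lemma is_derive_geodesic_grad phi x xi s : sphere x -> sphere xi -> tangent x xi ->
  sdifferentiable phi (geodesic x xi s) ->
  is_derive s 1 (phi \o geodesic x xi)
    (dotv (sgrad phi (geodesic x xi s)) (- sin s *: x + cos s *: xi)).
Proof.
move=> Sx Sxi xxi dphi; apply: sphere_curve_grad => //; last exact: is_derive_geodesic.
by apply: filterE => t; exact: sphere_geodesic.
Qed.

Lemma is_derive_geodesic_grad0 phi x xi : sphere x -> sphere xi -> tangent x xi ->
  sdifferentiable phi x ->
  is_derive (0 : R) 1 (phi \o geodesic x xi) (dotv (sgrad phi x) xi).
Proof.
move=> Sx Sxi xxi dphi.
have := @is_derive_geodesic_grad phi x xi 0 Sx Sxi xxi; rewrite geodesic0 => /(_ dphi).
by rewrite sin0 cos0 oppr0 scale0r add0r scale1r.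
Qed.

Lemma cost_self x : sphere x -> cost x x = 0.
Proof. by move=> Sx; rewrite /cost /geodist sphere_dotv// acos1 expr0n mulr0. Qed.

Lemma acos_cos_norm s : `|s| <= pi -> acos (cos s) ^+ 2 = s ^+ 2.
Proof.
move=> spi; have [s0|s0] := leP 0 s.
  by rewrite cosK// in_itv/= s0 -(ger0_norm s0).
by rewrite cosKN ?sqrrN// (ltW s0) andbT lerNl -(ltr0_norm s0).
Qed.

Lemma cost_geodesic_self x xi s : sphere x -> tangent x xi -> `|s| <= pi ->
  cost (geodesic x xi s) x = 2^-1 * s ^+ 2.
Proof.
move=> Sx xxi spi; rewrite cost_geodesic /geo_cos sphere_dotv// (dotvC xi) xxi.
by rewrite mulr0 addr0 mulr1 acos_cos_norm.
Qed.

Definition c_support phi x y := forall z, sphere z -> phi x + cost x y <= phi z + cost z y.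

Lemma dotv_eq1 x y : sphere x -> sphere y -> dotv x y = 1 -> y = x.
Proof.
move=> Sx Sy xy; apply/eqP; rewrite -subr_eq0 -dotv_eq0.
by rewrite dotvBl !dotvBr !sphere_dotv// (dotvC y x) xy; apply/eqP; ring.
Qed.

Lemma near_norm_le_pi : \forall s \near (0 : R), `|s| <= pi.
Proof.
have : \forall s \near (0 : R), `|s| < pi by apply: nbhs0_lt; exact: pi_gt0.
by apply: filterS => s /ltW.
Qed.

(** The first-order condition along geodesics gives
    grad phi = (theta / sin theta) (y - cos theta x), with theta the distance
    of x and y; this is the vector v with exp_x v = y. *)
Lemma c_support_interior phi x y : sphere x -> sphere y -> sdifferentiable phi x ->
  -1 < dotv x y < 1 -> c_support phi x y -> y = gradmap phi x.
Proof.
move=> Sx Sy dphi hm sup; have [xv _] := sgradP phi Sx.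
rewrite /gradmap; set v := sgrad phi x in xv *; pose q := y - dotv x y *: x.
have xq : dotv x q = 0 by rewrite dotvBr dotvZr sphere_dotv// mulr1 subrr.
have qq : dotv q q = 1 - dotv x y ^+ 2.
  by rewrite {1}/q dotvBl dotvZl xq mulr0 subr0 dotvBr dotvZr (dotvC y x) sphere_dotv.
(* q is the component of y orthogonal to x *)
have vE : v + dcost (dotv x y) *: q = 0.
  apply: (@tangent_eq0 x).
    by rewrite /tangent/= dotvDr dotvZr xq xv mulr0 addr0.
  move=> xi Sxi xxi; have D1 := is_derive_geodesic_grad0 Sx Sxi xxi dphi.
  have m0 : geo_cos x xi y 0 = dotv x y by rewrite /geo_cos cos0 sin0 mul1r mul0r addr0.
  have := @is_derive_cost_geodesic _ _ x xi y 0; rewrite m0 => /(_ hm).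
  rewrite sin0 cos0 oppr0 mul0r add0r mul1r => D2.
  have := right_min_derive_ge0 (is_deriveD D1 D2).
  rewrite dotvDl dotvZl -/v; have -> : dotv q xi = dotv xi y.
    by rewrite dotvBl dotvZl xxi mulr0 subr0 dotvC.
  apply; apply: filterE => s _; have := sup _ (sphere_geodesic s Sx Sxi xxi).
  by rewrite !fctE/= geodesic0.
have s0 : 0 < Num.sqrt (1 - dotv x y ^+ 2) by rewrite sqrtr_gt0; nra.
have t0 : 0 < acos (dotv x y) by apply: acos_gt0; lra.
have vE' : v = (acos (dotv x y) / Num.sqrt (1 - dotv x y ^+ 2)) *: q.
  by apply/eqP; rewrite -subr_eq0 -scaleNr -vE.
have nq : enorm q = Num.sqrt (1 - dotv x y ^+ 2) by rewrite /enorm qq.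
have nv : enorm v = acos (dotv x y).
  by rewrite vE' enormZ nq gtr0_norm ?divr_gt0// divfK// gt_eqF.
rewrite /sexp nv acosK ?in_itv/=; last lra.
rewrite sin_acos; last lra.
rewrite vE' scalerA; have -> : Num.sqrt (1 - dotv x y ^+ 2) / acos (dotv x y) *
   (acos (dotv x y) / Num.sqrt (1 - dotv x y ^+ 2)) = 1 by field; rewrite !gt_eqF.
by rewrite scale1r /q addrC subrK.
Qed.

(** Along a unit speed geodesic from x the cost c(., x) is s^2 / 2, without
    first-order term, so that the gradient vanishes. *)
Lemma c_support_self phi x : sphere x -> sdifferentiable phi x ->
  c_support phi x x -> x = gradmap phi x.
Proof.
move=> Sx dphi sup; have [xv _] := sgradP phi Sx.
suff -> : gradmap phi x = sexp x 0 by rewrite /sexp enorm0 cos0 scale1r scaler0 addr0.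
congr sexp; apply: (@tangent_eq0 x) => // xi Sxi xxi.
have D1 := is_derive_geodesic_grad0 Sx Sxi xxi dphi.
have D2 : is_derive (0 : R) 1 (fun s : R => 2^-1 * s ^+ 2) 0.
  by apply: is_derive_eq; rewrite /GRing.scale/=; ring.
have := right_min_derive_ge0 (is_deriveD D1 D2); rewrite addr0; apply.
have := near_norm_le_pi; apply: filterS => s spi _.
have := sup _ (sphere_geodesic s Sx Sxi xxi).
by rewrite !fctE/= geodesic0 cost_self// cost_geodesic_self// expr0n mulr0.
Qed.

(** Along a unit speed geodesic from x the cost to -x is (pi - |s|)^2 / 2, with a
    concave corner at 0, so that phi + c(., -x) cannot have a minimum at x if
    phi is differentiable there. The vector xi witnesses that the sphere has
    positive dimension. *)
Lemma c_support_antipode phi x xi : sphere x -> sdifferentiable phi x ->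
  sphere xi -> tangent x xi -> ~ c_support phi x (- x).
Proof.
move=> Sx dphi Sxi xxi sup.
have H xi' : sphere xi' -> tangent x xi' -> pi <= dotv (sgrad phi x) xi'.
  move=> S' x'; have D1 := is_derive_geodesic_grad0 Sx S' x' dphi.
  have D2 : is_derive (0 : R) 1 (fun s : R => 2^-1 * (pi - s) ^+ 2) (- pi).
    by apply: is_derive_eq; rewrite /GRing.scale/=; field.
  have := right_min_derive_ge0 (is_deriveD D1 D2); rewrite subr_ge0; apply.
  have := near_norm_le_pi; apply: filterS => s spi s0.
  have := sup _ (sphere_geodesic s Sx S' x').
  rewrite !fctE/= geodesic0 /cost /geodist !dotvNr sphere_dotv// acosN1 subr0.
  rewrite acosN; last by apply: dotv_sphere_itv => //; exact: sphere_geodesic.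
  suff -> : acos (dotv (geodesic x xi' s) x) = s by [].
  rewrite /geodesic dotvDl !dotvZl sphere_dotv// (dotvC xi') x' mulr0 addr0 mulr1.
  by rewrite cosK// in_itv/= s0 -(ger0_norm s0).
have := H _ Sxi xxi; have := H _ (sphereN Sxi) (tangentN xxi).
by rewrite dotvNr; have := @pi_gt0 R; lra.
Qed.

(** Along the geodesic with velocity xi, the second derivative of phi at 0 is
    <D xi, xi>, and that of the cost is obtained from acos (m s)^2 / 2, where
    m is the inner product with y. If the gradient vanishes then y = x, acos is
    not differentiable at m 0 = 1, and the cost is s^2 / 2 instead. *)
Lemma second_order_unit phi x xi : sphere x -> sphere xi -> tangent x xi ->
  has_hessian phi x -> enorm (sgrad phi x) < pi ->
  c_support phi x (gradmap phi x) ->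
  0 <= dotv (sdiff (sgrad phi) x xi) xi + hess_cost (sgrad phi x) xi.
Proof.
move=> Sx Sxi xxi [nphi dG] vpi sup; have [xv _] := sgradP phi Sx.
have nD : \forall s \near (0 : R), is_derive (s : R) 1 (phi \o geodesic x xi)
    (dotv (sgrad phi (geodesic x xi s)) (- sin s *: x + cos s *: xi)).
  have := near_geodesic Sx Sxi xxi nphi; apply: filterS => s.
  exact: is_derive_geodesic_grad.
have DG : is_derive (0 : R) 1
    (fun s : R => dotv (sgrad phi (geodesic x xi s)) (- sin s *: x + cos s *: xi))
    (dotv (sdiff (sgrad phi) x xi) xi).
  have D := is_derive_geodesic x xi 0.
  have Sg : \forall s \near (0 : R), sphere (geodesic x xi s).
    by apply: filterE => s; exact: sphere_geodesic.
  have := @sphere_curve_diff R n _ (sgrad phi) (geodesic x xi) _ 0 Sg; rewrite geodesic0.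
  move=> /(_ _ dG D) D1.
  have D2 := is_derive_comb x xi (is_deriveN (is_derive_sin 0)) (is_derive_cos 0).
  apply: (is_derive_eq (is_derive_dotv D1 D2)) => /=.
  rewrite geodesic0 sin0 cos0 !fctE sin0 oppr0 !scale0r add0r addr0 !scale1r.
  by rewrite scaleN1r dotvNr (dotvC _ x) xv oppr0 addr0.
have sup' s : phi x + cost x (gradmap phi x)
    <= phi (geodesic x xi s) + cost (geodesic x xi s) (gradmap phi x).
  exact/sup/sphere_geodesic.
have [v vE] : exists v, v = sgrad phi x by exists (sgrad phi x).
move: sup' DG; rewrite /gradmap -vE; rewrite -vE in xv vpi => {}sup DG.
pose g s := dotv (sgrad phi (geodesic x xi s)) (- sin s *: x + cos s *: xi).
have g0 : g 0 = dotv v xi.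
  by rewrite /g geodesic0 -vE sin0 cos0 oppr0 scale0r add0r scale1r.
(* here y = x *)
have [v0|v0] := eqVneq v 0.
  move: sup g0; rewrite v0 /sexp enorm0 cos0 scale1r scaler0 addr0 cost_self// => sup g0.
  rewrite /hess_cost enorm0 rcot0 dot0v expr0n mulr0 addr0 mul1r sphere_dotv//.
  have Dq s : is_derive s 1 (fun s : R => 2^-1 * s ^+ 2) s.
    by apply: is_derive_eq; rewrite /GRing.scale/=; field.
  apply: (@second_order_min R (fun s => phi (geodesic x xi s) + 2^-1 * s ^+ 2) (fun s => g s + s)).
  - by apply: filterS nD => s Ds; exact: is_deriveD Ds (Dq s).
  - by rewrite g0 dot0v addr0.
  have := near_norm_le_pi; apply: filterS => s spi; have := sup s.
  by rewrite geodesic0 cost_geodesic_self// expr0n mulr0.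
have r0 : 0 < enorm v by rewrite lt_neqAle enorm_ge0 eq_sym enorm_eq0 v0.
have hr : 0 < enorm v < pi by rewrite r0.
have s0 := sin_gt0_pi hr.
move: sup; set y := sexp x v => sup.
have xy : dotv x y = cos (enorm v).
  by rewrite /y /sexp dotvDr !dotvZr xv sphere_dotv// mulr1 mulr0 addr0.
have xiy : dotv xi y = sin (enorm v) / enorm v * dotv v xi.
  by rewrite /y /sexp dotvDr !dotvZr (dotvC xi x) xxi mulr0 add0r (dotvC xi).
have hm : -1 < dotv x y < 1.
  by rewrite xy; have := cos2Dsin2 (enorm v); nra.
pose m := geo_cos x xi y; have m0 : m 0 = dotv x y.
  by rewrite /m /geo_cos cos0 sin0 mul1r mul0r addr0.
pose dm s := - sin s * dotv x y + cos s * dotv xi y.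
have Dm s : is_derive s 1 m (dm s) by exact: is_derive_geo_cos.
have Ddm : is_derive (0 : R) 1 dm (- dotv x y).
  have D1 := is_derive_sin (0 : R); have D2 := is_derive_cos (0 : R).
  by rewrite /dm; apply: is_derive_eq; rewrite /GRing.scale/= sin0 cos0; ring.
have hm0 : -1 < m 0 < 1 by rewrite m0.
have Dc := @is_derive1_comp _ (@dcost R) m 0 _ _ (is_derive_dcost hm0) (Dm 0).
have DdC := is_deriveM Dc Ddm.
have H := @second_order_min R (fun s => phi (geodesic x xi s) + cost (geodesic x xi s) y)
  (fun s => g s + dcost (m s) * dm s) _ _ (is_deriveD DG DdC).
have dm0 : dm 0 = dotv xi y by rewrite /dm sin0 cos0 oppr0 mul0r add0r mul1r.
have sE : Num.sqrt (1 - dotv x y ^+ 2) = sin (enorm v).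
  by rewrite xy -sin2cos2 sqrtr_sqr gtr0_norm.
have aE : acos (dotv x y) = enorm v by rewrite xy cosK// in_itv/= !ltW.
have -> : hess_cost v xi = (@dcost R \o m) 0 *: (- dotv x y) + dm 0 *: (((1 - m 0 ^+ 2)^-1
    - acos (m 0) * m 0 / Num.sqrt (1 - m 0 ^+ 2) ^+ 3) * dm 0).
  rewrite /= dm0 m0 /dcost sE aE xy -sin2cos2 xiy /hess_cost sphere_dotv//.
  rewrite rcotE ?gt_eqF// /GRing.scale/=.
  by field; rewrite !gt_eqF.
apply: H.
- have := near_geo_cos xi hm; move: nD; apply: filterS2 => s Ds hs.
  exact: is_deriveD Ds (is_derive_cost_geodesic hs).
- rewrite g0 dm0 m0 /dcost sE aE xiy; field; rewrite !gt_eqF//.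
- by apply: filterE => s; rewrite geodesic0.
Qed.

Lemma second_order phi x w : sphere x -> tangent x w ->
  has_hessian phi x -> enorm (sgrad phi x) < pi ->
  c_support phi x (gradmap phi x) ->
  0 <= dotv (sdiff (sgrad phi) x w) w + hess_cost (sgrad phi x) w.
Proof.
move=> Sx xw hphi vpi sup.
have [->|w0] := eqVneq w 0.
  by rewrite /hess_cost !dotv0 expr0n !mulr0 !addr0.
have [S1 T1] := unit_tangent w0 xw.
have := second_order_unit Sx S1 T1 hphi vpi sup.
have -> : sdiff (sgrad phi) x ((enorm w)^-1 *: w) = (enorm w)^-1 *: sdiff (sgrad phi) x w.
  by rewrite /sdiff linearZ.
move: (sdiff _ _ w) (sgrad phi x) => h v.
rewrite /hess_cost !dotvZl !dotvZr => H.
have n0 : 0 < enorm w by rewrite lt_neqAle enorm_ge0 eq_sym enorm_eq0 w0.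
have n2 : 0 < (enorm w)^-1 ^+ 2 by rewrite exprn_gt0// invr_gt0.
rewrite -(pmulr_rge0 _ n2); move: H; congr (_ <= _); ring.
Qed.

End Optimality.

Section Support.
Variables (R : realType) (n : nat).

(** A c-subgradient can be neither antipodal to x nor different from
    exp_x (grad phi (x)), by the first-order conditions. *)
Lemma c_convex_support (phi : 'rV[R]_n.+2 -> R) x : c_convex phi -> sphere x ->
  sdifferentiable phi x -> c_support phi x (gradmap phi x).
Proof.
move=> cphi Sx dphi; have [y Sy sup] := c_subdifferential cphi Sx.
suff <- : y = gradmap phi x by [].
have /andP[h1 h2] := dotv_sphere_itv Sx Sy.
have [e1|n1] := eqVneq (dotv x y) 1.
  move: sup; rewrite (dotv_eq1 Sx Sy e1); exact: c_support_self.
have [e2|n2] := eqVneq (dotv x y) (-1).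
  have yE : y = - x.
    have /(dotv_eq1 Sx (sphereN Sy)) <- : dotv x (- y) = 1 by rewrite dotvNr e2 opprK.
    by rewrite opprK.
  have [B1 B2 _] := oframeP Sx; exfalso.
  rewrite yE in sup; apply: (c_support_antipode Sx dphi _ (B2 ord0) sup).
  have BB : (oframe x *m (oframe x)^T) ord0 ord0 = 1 by rewrite B1 mxE eqxx.
  apply: dotv_sphere; rewrite -[RHS]BB /dotv !mxE.
  by apply: eq_bigr => i _; rewrite !mxE.
apply: c_support_interior => //; rewrite !lt_neqAle h1 h2 (eq_sym (-1)).
by rewrite n1 n2.
Qed.

End Support.

(** * Log-concavity of the Jacobian *)

Section LogConcave.
Variable R : realType.

(** Where f vanishes its logarithm is -oo, and so is the convex combination unless
    its weight is 0; only positive values have to be considered. *)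
Lemma log_concave_on_ln (D : set R) (f : R -> R) :
  (forall t, D t -> 0 <= f t) ->
  (forall s t l : R, D s -> D t -> 0 <= l <= 1 -> 0 < f s -> 0 < f t ->
     0 < f ((1 - l) * s + l * t) /\
     (1 - l) * ln (f s) + l * ln (f t) <= ln (f ((1 - l) * s + l * t))) ->
  log_concave_on D f.
Proof.
move=> f0 fln; split=> // s t l Ds Dt l01; have /andP[l0 l1] := l01.
have [l_0|ln0] := eqVneq l 0.
  by rewrite l_0 subr0 mul1e mul0e adde0 mul1r mul0r addr0.
have [l_1|ln1] := eqVneq l 1.
  by rewrite l_1 subrr mul1e mul0e add0e mul1r mul0r add0r.
have lpos : 0 < l by rewrite lt_neqAle eq_sym ln0.
have lpos' : 0 < 1 - l by rewrite subr_gt0 lt_neqAle ln1.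
have [fs|fs] := leP (f s) 0.
  by rewrite (@le0_lneNy _ (f s)%:E)// gt0_muleNy// addNye leNye.
have [ft|ft] := leP (f t) 0.
  by rewrite (@le0_lneNy _ (f t)%:E)// gt0_muleNy// addeNy leNye.
have [fl h] := fln s t l Ds Dt l01 fs ft.
by rewrite !lne_EFin// -!EFinM -EFinD lee_fin.
Qed.

Lemma log_concave_on01 (f : R -> R) : log_concave_on `[0, 1] f ->
  forall t : R, 0 <= t <= 1 ->
    ((1 - t)%:E * lne (f 0)%:E + t%:E * lne (f 1)%:E <= lne (f t)%:E)%E.
Proof.
move=> [_ h] t t01; have := h 0 1 t; rewrite mulr0 mulr1 add0r; apply=> //.
  by rewrite /= in_itv/= lexx ler01.
by rewrite /= in_itv/= lexx ler01.
Qed.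

End LogConcave.

Lemma ln_expn_mul_concave (R : realType) n (a0 a1 a d0 d1 d l : R) :
  0 < a0 -> 0 < a1 -> 0 < a -> 0 < d0 -> 0 < d1 -> 0 < d ->
  (1 - l) * ln a0 + l * ln a1 <= ln a -> (1 - l) * ln d0 + l * ln d1 <= ln d ->
  (1 - l) * ln (a0 ^+ n * d0) + l * ln (a1 ^+ n * d1) <= ln (a ^+ n * d).
Proof.
move=> a00 a10 apos d00 d10 dpos /(ler_wpM2l (ler0n R n)) ha hd.
have E b e : 0 < b -> 0 < e -> ln (b ^+ n * e) = n%:R * ln b + ln e.
  by move=> b0 e0; rewrite lnM ?posrE ?exprn_gt0// lnXn// mulr_natl.
rewrite !E//; lra.
Qed.

Lemma lin1_mx_comb (R : pzRingType) m p (f f0 f1 : 'rV[R]_m -> 'rV[R]_p) (a b : R) :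
  f = a *: f0 + b *: f1 -> lin1_mx f = a *: lin1_mx f0 + b *: lin1_mx f1.
Proof. by move=> ->; apply/matrixP => i j; rewrite !mxE. Qed.

Lemma affine_comb (R : pzRingType) (V : lmodType R) (a b : V) (s t l : R) :
  (1 - ((1 - l) * s + l * t)) *: a + ((1 - l) * s + l * t) *: b =
  (1 - l) *: ((1 - s) *: a + s *: b) + l *: ((1 - t) *: a + t *: b).
Proof.
rewrite !scalerDr !scalerA addrACA -!scalerDl; congr (_ *: _ + _ *: _).
by rewrite !mulrBr !mulr1 addrACA -opprD subrK.
Qed.

Section JacobianAlongSegment.
Variables (R : realType) (n : nat).
Variables (x v0 v1 : 'rV[R]_n.+2) (D0 D1 : 'M[R]_n.+2).
Hypotheses (Sx : sphere x) (xv0 : tangent x v0) (xv1 : tangent x v1).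
Hypotheses (v0pi : enorm v0 < pi) (v1pi : enorm v1 < pi).

Definition tangent_sym (D : 'M[R]_n.+2) := forall u w, tangent x u -> tangent x w ->
  dotv (u *m D) w = dotv (w *m D) u.
Definition tangent_psd (v : 'rV[R]_n.+2) (D : 'M[R]_n.+2) := forall w, tangent x w ->
  0 <= dotv (w *m D) w + hess_cost v w.

Hypotheses (sym0 : tangent_sym D0) (sym1 : tangent_sym D1).
Hypotheses (psd0 : tangent_psd v0 D0) (psd1 : tangent_psd v1 D1).

Let grad_at t := (1 - t) *: v0 + t *: v1.
Let hess_at t := (1 - t) *: D0 + t *: D1.
Let form_at t := jac_form x (grad_at t) (hess_at t).

Lemma mul_hess_at (t : R) (w : 'rV[R]_n.+2) : w *m hess_at t = (1 - t) *: (w *m D0) + t *: (w *m D1).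
Proof. by rewrite mulmxDr -!scalemxAr. Qed.

Lemma grad_at_lt t : 0 <= t <= 1 -> enorm (grad_at t) < pi.
Proof. by move=> t01; exact: enorm_conv_lt. Qed.

Lemma grad_at_tangent t : tangent x (grad_at t).
Proof. by rewrite /tangent/= dotvDr !dotvZr xv0 xv1 !mulr0 addr0. Qed.

Lemma form_at_sym t : (form_at t)^T = form_at t.
Proof.
apply: jac_form_sym; last exact: sphere_dotv.
move=> u w xu xw; rewrite !mul_hess_at !dotvDl !dotvZl.
by rewrite (sym0 xu xw) (sym1 xu xw).
Qed.

Lemma qform_form_at t u : qform (form_at t) u = dotv x u ^+ 2
    + (dotv (u *m tproj x *m hess_at t) (u *m tproj x) + hess_cost (grad_at t) (u *m tproj x)).
Proof. by apply: qform_jac_form; [exact: sphere_dotv | exact: grad_at_tangent]. Qed.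

Lemma form_at_concave s t l u : 0 <= s <= 1 -> 0 <= t <= 1 -> 0 <= l <= 1 ->
  (1 - l) * qform (form_at s) u + l * qform (form_at t) u
    <= qform (form_at ((1 - l) * s + l * t)) u.
Proof.
move=> s01 t01 l01; rewrite !qform_form_at.
have -> : grad_at ((1 - l) * s + l * t) = (1 - l) *: grad_at s + l *: grad_at t.
  exact: affine_comb.
have -> : hess_at ((1 - l) * s + l * t) = (1 - l) *: hess_at s + l *: hess_at t.
  exact: affine_comb.
have := hess_cost_concave (u *m tproj x) l01 (grad_at_lt s01) (grad_at_lt t01).
move: (grad_at s) (grad_at t) (hess_at s) (hess_at t) (u *m tproj x) => a b A B w.
rewrite mulmxDr -!scalemxAr dotvDl !dotvZl; lra.
Qed.

Lemma form_at_psd t : 0 <= t <= 1 -> psd (form_at t).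
Proof.
move=> t01; split=> [|u]; first exact: form_at_sym.
rewrite qform_form_at addr_ge0 ?sqr_ge0// mul_hess_at.
have xw : tangent x (u *m tproj x).
  by rewrite /tangent/= mulmx_tproj dotvBr dotvZr sphere_dotv// mulr1 subrr.
move: (u *m tproj x) xw => w xw; rewrite dotvDl !dotvZl.
have := hess_cost_concave w t01 v0pi v1pi; rewrite -/(grad_at t).
have := psd0 xw; have := psd1 xw; case/andP: t01 => t0 t1; have : 0 <= 1 - t by lra.
move: (dotv _ _) (dotv _ _) (hess_cost _ _) (hess_cost _ _) (hess_cost _ _) => a b c d e.
nra.
Qed.

(** All the geometry is now in the hypotheses on D0, D1, v0 and v1, which concern
    the end points of the segment only. *)
Lemma jacobian_log_concave (J : R -> R) :
  (forall t, 0 <= t <= 1 -> J t = sinc (enorm (grad_at t)) ^+ n * \det (form_at t)) ->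
  log_concave_on `[0, 1] J.
Proof.
move=> JE; have D01 (t : R) : `[0, 1]%classic t -> 0 <= t <= 1 by rewrite /= in_itv.
have norm_itv t : 0 <= t <= 1 -> 0 <= enorm (grad_at t) < pi.
  by move=> t01; rewrite enorm_ge0 grad_at_lt.
have sinc_pos t : 0 <= t <= 1 -> 0 < sinc (enorm (grad_at t)).
  by move=> t01; rewrite sinc_gt0// norm_itv.
apply: log_concave_on_ln => [t /D01 t01|s t l /D01 s01 /D01 t01 l01].
  rewrite JE// mulr_ge0 ?exprn_ge0 ?(ltW (sinc_pos _ t01))//.
  exact/psd_det_ge0/form_at_psd.
have r01 : 0 <= (1 - l) * s + l * t <= 1.
  case/andP: s01 => ? ?; case/andP: t01 => ? ?; case/andP: l01 => ? ?.
  by apply/andP; split; nra.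
have ss := sinc_pos _ s01; have st := sinc_pos _ t01; have sr := sinc_pos _ r01.
rewrite (JE _ s01) (JE _ t01) (JE _ r01).
rewrite (pmulr_rgt0 _ (exprn_gt0 n ss)) (pmulr_rgt0 _ (exprn_gt0 n st)) => ds dt.
have [dr lr] := det_log_concave l01 (form_at_psd s01) (form_at_psd t01) (form_at_psd r01)
  (fun u => form_at_concave u s01 t01 l01) ds dt.
split; first exact: mulr_gt0 (exprn_gt0 n sr) dr.
have rle : enorm (grad_at ((1 - l) * s + l * t)) <=
    (1 - l) * enorm (grad_at s) + l * enorm (grad_at t).
  have -> : grad_at ((1 - l) * s + l * t) = (1 - l) *: grad_at s + l *: grad_at t.
    exact: affine_comb.
  exact: enorm_conv.
apply: ln_expn_mul_concave ss st sr ds dt dr _ lr.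
exact: ln_sinc_concave l01 (norm_itv _ s01) (norm_itv _ t01) (norm_itv _ r01) rle.
Qed.

End JacobianAlongSegment.

(** Linearity in phi of the gradient near x, and hence of its differential. *)
Lemma hess_mx_interp (R : realType) n (phi0 phi1 : 'rV[R]_n.+1 -> R) x t : sphere x ->
  has_hessian phi0 x -> has_hessian phi1 x ->
  hess_mx (phi_interp phi0 phi1 t) x = (1 - t) *: hess_mx phi0 x + t *: hess_mx phi1 x.
Proof.
move=> Sx h0 h1; have [_ D2] := sgrad_interp_diff t Sx h0 h1.
exact: lin1_mx_comb D2.
Qed.

Lemma hessian_tangent_sym (R : realType) n (phi : 'rV[R]_n.+2 -> R) x : sphere x ->
  has_hessian phi x -> tangent_sym x (hess_mx phi x).
Proof. by move=> Sx hphi u w xu xw; rewrite !mul_hess_mx; exact: hessian_sym. Qed.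

Lemma c_convex_tangent_psd (R : realType) n (phi : 'rV[R]_n.+2 -> R) x : sphere x ->
  c_convex phi -> enorm (sgrad phi x) < pi -> has_hessian phi x ->
  tangent_psd x (sgrad phi x) (hess_mx phi x).
Proof.
move=> Sx cphi gphi hphi w xw; rewrite mul_hess_mx; apply: second_order => //.
by apply: c_convex_support => //; case: hphi => h _; exact: (nbhs_singleton h).
Qed.

Lemma J_interp_log_concave (R : realType) n (phi0 phi1 : 'rV[R]_n.+1 -> R) x :
  c_convex phi0 -> c_convex phi1 -> sphere x ->
  enorm (sgrad phi0 x) < pi -> enorm (sgrad phi1 x) < pi ->
  has_hessian phi0 x -> has_hessian phi1 x ->
  log_concave_on `[0, 1] (J_interp phi0 phi1 x).
Proof.
(* On the sphere of dimension 0 the Jacobian is an empty determinant. *)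
case: n phi0 phi1 x => [|n] phi0 phi1 x c0 c1 Sx g0 g1 h0 h1.
  have -> : J_interp phi0 phi1 x = cst 1 by apply/funext => t; exact: det_mx00.
  apply: log_concave_on_ln => [t _|s t l _ _ _ _ _] /=; first exact: ler01.
  by rewrite ln1 !mulr0 addr0 ltr01.
apply: (@jacobian_log_concave R n x (sgrad phi0 x) (sgrad phi1 x)
  (hess_mx phi0 x) (hess_mx phi1 x) Sx).
- by have [] := sgradP phi0 Sx.
- by have [] := sgradP phi1 Sx.
- exact: g0.
- exact: g1.
- exact: hessian_tangent_sym.
- exact: hessian_tangent_sym.
- exact: c_convex_tangent_psd.
- exact: c_convex_tangent_psd.
move=> t t01.
have gE : sgrad (phi_interp phi0 phi1 t) x = (1 - t) *: sgrad phi0 x + t *: sgrad phi1 x.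
  by apply: sgrad_interp => //; [case: h0 => h _ | case: h1 => h _]; exact: (nbhs_singleton h).
have [dG _] := sgrad_interp_diff t Sx h0 h1.
rewrite /J_interp (sjac_gradmap Sx dG); last by rewrite gE; exact: enorm_conv_lt.
by rewrite gE (hess_mx_interp t Sx h0 h1).
Qed.

Theorem theorem1 (R : realType) (n : nat) (phi0 phi1 : 'rV[R]_n.+1 -> R)
    (x : 'rV[R]_n.+1)
    (cvx0 : c_convex phi0) (cvx1 : c_convex phi1)
    (Sx : sphere x)
    (grad0 : enorm (sgrad phi0 x) < pi) (grad1 : enorm (sgrad phi1 x) < pi)
    (hess0 : has_hessian phi0 x) (hess1 : has_hessian phi1 x) :
  log_concave_on `[0, 1] (J_interp phi0 phi1 x) /\
  (forall t : R, 0 <= t <= 1 ->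
    ((1 - t)%:E * lne (J_interp phi0 phi1 x 0)%:E
       + t%:E * lne (J_interp phi0 phi1 x 1)%:E
     <= lne (J_interp phi0 phi1 x t)%:E)%E).
Proof.
have h : log_concave_on `[0, 1] (J_interp phi0 phi1 x) by exact: J_interp_log_concave.
by split=> //; exact: log_concave_on01.
Qed.
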